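(* Let $P_{\rm exp}(a,b_1,b_2|x,y_1,y_2)$, with $a,b_1,b_2\in\{\pm1\}$ and $x,y_1,y_2\in\{0,1\}$, be a sequential quantum correlation, and let $H_{\min}=-\log_2 G$ be its min-entropy evaluated for the input sequence $\mathbf y_r=(y_1,y_2)=(0,1)$, where $G$ is the adversary's maximal guessing probability. If $\langle S_c\rangle=2\sqrt2$ and $\langle S_\theta\rangle=\sqrt2$ for a given real $\theta$ with $\theta\ne n\frac{\pi}{4}$ for every integer $n$, then $H_{\min}=2$ (equivalently $G=\tfrac14$). If $\langle S_c\rangle=2\sqrt2$ and $\langle S_\theta\rangle=\sqrt2$ for some $\theta=n\frac{\pi}{4}$ with $n$ an integer, then $H_{\min}=1$ (equivalently $G=\tfrac12$).
   Context: Sequential quantum correlations: $p(a,b_1,b_2|x,y_1,y_2)$ is a sequential quantum correlation if there are Hilbert spaces $\mathcal H_A,\mathcal H_B$ (of arbitrary dimension), a unit vector $|\psi\rangle\in\mathcal H_A\otimes\mathcal H_B$, Hermitian unitary operators $A_x$ on $\mathcal H_A$ and Hermitian unitary operators $B_{y_1}$, $B_{y_1,y_2}$ on $\mathcal H_B$ ($x,y_1,y_2\in\{0,1\}$) with $[B_{y_1},B_{y_1,y_2}]=0$ for all $y_1,y_2$, such that $$p(a,b_1,b_2|x,y_1,y_2)=\langle\psi|\Lambda^x_a\otimes\Pi^{y_1}_{b_1}\Pi^{y_1,y_2}_{b_2}|\psi\rangle,$$ where $\Lambda^x_a=\frac{\mathbb 1+aA_x}{2}$, $\Pi^{y_1}_{b_1}=\frac{\mathbb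 1+b_1B_{y_1}}2$, $\Pi^{y_1,y_2}_{b_2}=\frac{\mathbb 1+b_2B_{y_1,y_2}}2$ are the eigenprojectors. CHSH quantities: with $\langle\cdot\rangle=\langle\psi|\cdot|\psi\rangle$, let $$S_1=(A_0+A_1)B_0+(A_0-A_1)B_1,\quad S_2=(A_0+A_1)B_{0,0}+(A_0-A_1)B_{0,1},\quad S_c=(A_0+A_1)B_{0,0}+(A_0-A_1)B_1,$$ $$S_\theta=\cos2\theta\,(S_1-\sqrt2\,\mathbb 1)+\sin2\theta\,(S_2-\sqrt2\,\mathbb 1).$$ Their mean values depend only on the correlation $p$, since $\langle A_xB_{y_1}\rangle=\sum_{a,b_1,b_2}a\,b_1\,p(a,b_1,b_2|x,y_1,y_2)$ (independent of $y_2$) and $\langle A_xB_{y_1,y_2}\rangle=\sum_{a,b_1,b_2}a\,b_2\,p(a,b_1,b_2|x,y_1,y_2)$. In the claim they are evaluated on $P_{\rm exp}$. Guessing probability: an adversary Eve has a single measurement with outcomes $\mathbf e=(e_1,e_2)\in\{\pm1\}^2$. Writing $\mathbf b=(b_1,b_2)$, $\mathbf y=(y_1,y_2)$, $$G=\max_{p_{ABE}}\sum_{\mathbf b}p_{BE}(\mathbf b,\mathbf e=\mathbf b|\mathbf y_r),$$ where $p_{BE}$ is the marginal of $p_{ABE}$ over Alice's outcome (independent of $x$), and the maximum is over all $p_{ABE}(a,\mathbf b,\mathbf e|x,\mathbf y)$ such that (i) $\sum_{\mathbf e}p_{ABE}(a,\mathbf b,\mathbf e|x,\mathbf y)=P_{\rm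 exp}(a,\mathbf b|x,\mathbf y)$ for all $a,\mathbf b,x,\mathbf y$; and (ii) $p_{ABE}$ is sequential quantum (sequentiality applying only to the Bobs), i.e. there are Hilbert spaces $\mathcal H_A,\mathcal H_B,\mathcal H_E$, a unit vector $|\psi\rangle\in\mathcal H_A\otimes\mathcal H_B\otimes\mathcal H_E$, Hermitian unitary operators $A_x$ on $\mathcal H_A$ and Hermitian unitary operators $B_{y_1},B_{y_1,y_2}$ on $\mathcal H_B$ ($x,y_1,y_2\in\{0,1\}$) with $[B_{y_1},B_{y_1,y_2}]=0$ for all $y_1,y_2$, and orthogonal projectors $E_{\mathbf e}$ on $\mathcal H_E$ with $E_{\mathbf e}E_{\mathbf e'}=\delta_{\mathbf e\mathbf e'}E_{\mathbf e}$, $\sum_{\mathbf e}E_{\mathbf e}=\mathbb 1$, such that $$p_{ABE}(a,\mathbf b,\mathbf e|x,\mathbf y)=\langle\psi|\Lambda^x_a\otimes\Pi^{y_1}_{b_1}\Pi^{y_1,y_2}_{b_2}\otimes E_{\mathbf e}|\psi\rangle ,$$ where $\Lambda^x_a=\frac{\mathbb 1+aA_x}{2}$, $\Pi^{y_1}_{b_1}=\frac{\mathbb 1+b_1B_{y_1}}2$, $\Pi^{y_1,y_2}_{b_2}=\frac{\mathbb 1+b_2B_{y_1,y_2}}2$. The Hilbert spaces in (ii), the vector and the operators need not be those realizing $P_{\rm exp}$. *)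

(* Defs.v *)
From HB Require Import structures.
From mathcomp Require Import all_boot all_order all_algebra.
From mathcomp Require Import all_classical all_reals all_analysis.
From mathcomp Require Import complex.

Set Implicit Arguments.
Unset Strict Implicit.
Unset Printing Implicit Defensive.

Import Order.TTheory GRing.Theory Num.Theory.
Import numFieldNormedType.Exports.

Local Open Scope classical_set_scope.
Local Open Scope ring_scope.
Local Open Scope complex_scope.

(* Complex Hilbert spaces of arbitrary dimension.  Forms of type [{dot _ for _}]
   are linear in the FIRST argument and conjugate-linear in the second, so that
   the bracket <u|v> is [dot H v u]. *)
Record hilbertType (R : realType) : Type := HilbertType {
  hilbert_carrier :> completeNormedModType R[i];
  dot : {dot hilbert_carrier for Num.conj};
  dot_norm : forall u : hilbert_carrier, dot u u = `|u| ^+ 2 }.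

Definition hermitian_op (R : realType) (H : hilbertType R)
    (T : {linear H -> H}) : Prop :=
  forall u v, dot H (T u) v = dot H u (T v).

Definition unitary_op (R : realType) (H : hilbertType R)
    (T : {linear H -> H}) : Prop :=
  bijective T /\ forall u v, dot H (T u) (T v) = dot H u v.

Definition hermitian_unitary (R : realType) (H : hilbertType R)
    (T : {linear H -> H}) : Prop :=
  hermitian_op T /\ unitary_op T.

(* [HilbertTensor] presents a Hilbert space as the tensor product of H1 and H2;
   by density of the algebraic tensors and the formula for inner products, the
   presentation is unique up to a unitary compatible with [tens]. *)
Record hilbertTensor (R : realType) (H1 H2 : hilbertType R) : Type :=
  HilbertTensor {
    tensor_space :> hilbertType R;
    tens : {bilinear H1 -> H2 -> tensor_space};
    dot_tens : forall u1 v1 u2 v2,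
      dot tensor_space (tens u1 u2) (tens v1 v2) = dot H1 u1 v1 * dot H2 u2 v2;
    tens_dense :
      closure [set w : tensor_space | exists (n : nat) (u : 'I_n -> H1)
                 (v : 'I_n -> H2), w = \sum_(i < n) tens (u i) (v i)] = setT }.

(* T = T1 (x) T2: for bounded T1 and T2 such a T exists and is unique. *)
Definition is_tensor_op (R : realType) (H1 H2 : hilbertType R)
    (H : hilbertTensor H1 H2) (T : {linear H -> H})
    (T1 : H1 -> H1) (T2 : H2 -> H2) : Prop :=
  continuous T /\ forall u v, T (tens H u v) = tens H (T1 u) (T2 v).

(* Outcomes in {1, -1} are encoded by booleans, [o : bool] standing for
   [(-1) ^+ o]; the inputs 0 and 1 are [false] and [true]. *)
Definition eigenproj (R : realType) (H : hilbertType R) (T : {linear H -> H})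
    (o : bool) : H -> H :=
  fun u => 2^-1 *: (u + (-1) ^+ o *: T u).

(* [P a (b1, b2) x (y1, y2)] is p(a, b1, b2 | x, y1, y2). *)
Definition correlation (R : realType) : Type :=
  bool -> bool * bool -> bool -> bool * bool -> R.

(* [Q a (b1, b2) (e1, e2) x (y1, y2)] is p(a, b1, b2, e1, e2 | x, y1, y2). *)
Definition correlationE (R : realType) : Type :=
  bool -> bool * bool -> bool * bool -> bool -> bool * bool -> R.

Definition sequential_observables (R : realType) (HA HB : hilbertType R)
    (A : bool -> {linear HA -> HA}) (B1 : bool -> {linear HB -> HB})
    (B2 : bool -> bool -> {linear HB -> HB}) : Prop :=
  [/\ forall x, hermitian_unitary (A x),
      forall y1, hermitian_unitary (B1 y1),
      forall y1 y2, hermitian_unitary (B2 y1 y2) &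
      forall y1 y2 u, B1 y1 (B2 y1 y2 u) = B2 y1 y2 (B1 y1 u)].

Definition projective_measurement (R : realType) (I : finType)
    (H : hilbertType R) (E : I -> {linear H -> H}) : Prop :=
  [/\ forall e, hermitian_op (E e),
      forall e e' u, E e (E e' u) = if e == e' then E e u else 0 &
      forall u, \sum_(e : I) E e u = u].

Definition sequential_quantum (R : realType) (P : correlation R) : Prop :=
  exists (HA HB : hilbertType R) (HAB : hilbertTensor HA HB) (psi : HAB)
    (A : bool -> {linear HA -> HA}) (B1 : bool -> {linear HB -> HB})
    (B2 : bool -> bool -> {linear HB -> HB}),
  [/\ `|psi| = 1, sequential_observables A B1 B2 &
      forall a b x y, exists2 T : {linear HAB -> HAB},
        is_tensor_op T (eigenproj (A x) a)
          (eigenproj (B1 y.1) b.1 \o eigenproj (B2 y.1 y.2) b.2) &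
        (P a b x y)%:C = dot HAB (T psi) psi].

Definition sequential_quantumE (R : realType) (Q : correlationE R) : Prop :=
  exists (HA HB HE : hilbertType R) (HAB : hilbertTensor HA HB)
    (HABE : hilbertTensor HAB HE) (psi : HABE)
    (A : bool -> {linear HA -> HA}) (B1 : bool -> {linear HB -> HB})
    (B2 : bool -> bool -> {linear HB -> HB})
    (E : bool * bool -> {linear HE -> HE}),
  [/\ `|psi| = 1, sequential_observables A B1 B2, projective_measurement E &
      forall a b e x y, exists (T : {linear HAB -> HAB})
        (U : {linear HABE -> HABE}),
        [/\ is_tensor_op T (eigenproj (A x) a)
              (eigenproj (B1 y.1) b.1 \o eigenproj (B2 y.1 y.2) b.2),
            is_tensor_op U T (E e) &
            (Q a b e x y)%:C = dot HABE (U psi) psi]].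

(* <A_x B_{y1}>, which for a sequential quantum correlation does not depend on
   the second input of Bob; it is read off at y2 = 0. *)
Definition mean_AB1 (R : realType) (P : correlation R) (x y1 : bool) : R :=
  \sum_(a : bool) \sum_(b : bool * bool)
    (-1) ^+ a * (-1) ^+ b.1 * P a b x (y1, false).

(* <A_x B_{y1,y2}> *)
Definition mean_AB2 (R : realType) (P : correlation R) (x y1 y2 : bool) : R :=
  \sum_(a : bool) \sum_(b : bool * bool)
    (-1) ^+ a * (-1) ^+ b.2 * P a b x (y1, y2).

Definition mean_S1 (R : realType) (P : correlation R) : R :=
  (mean_AB1 P false false + mean_AB1 P true false)
  + (mean_AB1 P false true - mean_AB1 P true true).

Definition mean_S2 (R : realType) (P : correlation R) : R :=
  (mean_AB2 P false false false + mean_AB2 P true false false)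
  + (mean_AB2 P false false true - mean_AB2 P true false true).

Definition mean_Sc (R : realType) (P : correlation R) : R :=
  (mean_AB2 P false false false + mean_AB2 P true false false)
  + (mean_AB1 P false true - mean_AB1 P true true).

Definition mean_Stheta (R : realType) (P : correlation R) (theta : R) : R :=
  cos (2 * theta) * (mean_S1 P - Num.sqrt 2)
  + sin (2 * theta) * (mean_S2 P - Num.sqrt 2).

Definition extends_correlation (R : realType) (P : correlation R)
    (Q : correlationE R) : Prop :=
  forall a b x y, \sum_(e : bool * bool) Q a b e x y = P a b x y.

(* The marginal over Alice's outcome, which for a sequential quantum correlation
   does not depend on her input, is read off at x = 0. *)
Definition marginal_BE (R : realType) (Q : correlationE R) (b e y : bool * bool)
    : R :=
  \sum_(a : bool) Q a b e false y.

Definition guessing_values (R : realType) (P : correlation R) (y : bool * bool)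
    : set R :=
  [set g | exists Q : correlationE R,
     [/\ extends_correlation P Q, sequential_quantumE Q &
         g = \sum_(b : bool * bool) marginal_BE Q b b y]].

Definition is_guessing_probability (R : realType) (P : correlation R)
    (y : bool * bool) (G : R) : Prop :=
  guessing_values P y G /\ ubound (guessing_values P y) G.

Definition is_min_entropy (R : realType) (P : correlation R) (y : bool * bool)
    (h : R) : Prop :=
  exists2 G : R, is_guessing_probability P y G & h = - (ln G / ln 2).

(* Main.v *)
Require Import Defs.
From HB Require Import structures.
From mathcomp Require Import all_boot all_order all_algebra.
From mathcomp Require Import all_classical all_reals all_analysis.
From mathcomp Require Import complex sesquilinear.
From mathcomp Require Import ring lra.

Set Implicit Arguments.
Unset Strict Implicit.
Unset Printing Implicit Defensive.

Import Order.TTheory GRing.Theory Num.Theory.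
Import numFieldNormedType.Exports.

Local Open Scope classical_set_scope.
Local Open Scope ring_scope.
Local Open Scope complex_scope.

(* Let Z and X be (A_0 + A_1)/sqrt 2 and (A_0 - A_1)/sqrt 2: they anticommute, and
   Z^2 + X^2 = 2.  Maximality of <S_c> forces Z psi = B_00 psi and X psi = B_1 psi, and
   <S_theta> = sqrt 2 forces psi to be fixed by c Z B_0 + s X B_01, with c = cos 2 theta
   and s = sin 2 theta.  Eve commutes with these relations, so they hold for each
   conditional vector phi = E_e psi.  If an observable commutes with one of B_00, B_1,
   its product with the other Pauli observable of Alice has mean zero on phi.  When
   c s <> 0 this makes B_0, B_01 and B_0 B_01 have mean zero on phi, and Eve learns
   nothing.  When c s = 0, one of the two outcomes is a Pauli outcome, hence uniform
   for Eve, and the correlation factors so that the other outcome can be replaced by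
   classical noise of which Eve holds a copy: a mixture of deterministic strategies on
   a maximally entangled pair of qubits reproduces it. *)

(** * Euclidean spaces as Hilbert spaces *)

(** On a steered vector [Z B_0] and [X B_01] have unit square and anticommute, so
    [c Z B_0 + s X B_01] has square [c^2 + s^2 = 1]; the condition on [S_theta] puts psi at its top
    eigenvalue, which is how one scalar equation becomes a vector equation. Everything afterwards is
    an identity between vectors, with no bound on the dimension and no block decomposition. The
    obstacle is that a realization supplies, outcome by outcome, only product operators built from
    projectors, on completed tensor products where continuity is what makes a map determined by
    elementary tensors: the observables have to be rebuilt from these operators before any
    commutation can be used. Moreover G is a maximum, so it must also be attained. In the generic
    case all extensions have the same value and a trivial Eve attains it; in the degenerate case a
    realization has to be exhibited, whence the concrete Hilbert spaces built here. *)

Section DotNorm.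
Variables (C : numClosedFieldType) (U : lmodType C).
Variable form : {dot U for (@Num.conj C)}.

Lemma dot_conj u v : form u v = Num.conj (form v u).
Proof. by rewrite hermC /= expr0 mul1r. Qed.

(** Positivity of the square of [<v,v> u - <u,v> v], a multiple of the component of [u] orthogonal
    to [v] that avoids a division. *)
Lemma dot_cauchy_schwarz u v :
  `|form u v| ^+ 2 <= form u u * form v v.
Proof.
have [->|v0] := eqVneq v 0; first by rewrite linear0r normr0 expr0n mulr_ge0 ?dnorm_ge0.
have vv : 0 < form v v by rewrite dnorm_gt0.
have vvr : Num.conj (form v v) = form v v by rewrite -dot_conj.
have := dnorm_ge0 form (form v v *: u - form u v *: v).
rewrite linearBl !linearBr /= !linearZl_LR !linearZr_LR /= vvr -!(dot_conj v u) ?/GRing.scale /=.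
have -> : form v v * (form v v * form u u) - form v u * (form v v * form u v)
   - (form v v * (form u v * form v u) - form v u * (form u v * form v v))
   = form v v * (form u u * form v v - form u v * form v u) by ring.
by rewrite pmulr_rge0 // subr_ge0 normCK -(dot_conj v u).
Qed.

Definition dot_nrm u : C := sqrtC (form u u).

Lemma sqr_dot_nrm u : dot_nrm u ^+ 2 = form u u.
Proof. exact: sqrtCK. Qed.

Lemma dot_nrm_ge0 u : 0 <= dot_nrm u.
Proof. by rewrite sqrtC_ge0 dnorm_ge0. Qed.

Lemma dot_nrmD u v : dot_nrm (u + v) <= dot_nrm u + dot_nrm v.
Proof.
rewrite -(@ler_pXn2r _ 2) ?nnegrE ?addr_ge0 ?dot_nrm_ge0 //.
rewrite sqrrD !sqr_dot_nrm dnormD addrAC lerD2r lerD2l.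
have -> : form u v + Num.conj (form u v) = 2 * 'Re (form u v).
  by rewrite ReE mulrC divfK // pnatr_eq0.
rewrite -[leRHS]mulr_natl ler_pM2l ?ltr0n //.
apply: le_trans (_ : `|form u v| <= _).
  by have [-> _] := leif_Re_Creal (form u v).
rewrite -(@ler_pXn2r _ 2) ?nnegrE ?mulr_ge0 ?dot_nrm_ge0 //.
by rewrite exprMn !sqr_dot_nrm dot_cauchy_schwarz.
Qed.

Lemma dot_nrmZ a u : dot_nrm (a *: u) = `|a| * dot_nrm u.
Proof.
apply/eqP; rewrite -(@eqrXn2 _ 2) ?mulr_ge0 ?dot_nrm_ge0 //.
by rewrite exprMn !sqr_dot_nrm dnormZ.
Qed.

Lemma dot_nrm_eq0 u : dot_nrm u = 0 -> u = 0.
Proof. by move/eqP; rewrite sqrtC_eq0 dnorm_eq0 => /eqP. Qed.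

End DotNorm.

Section EuclideanSpace.
Variables (R : realType) (I : finType).

Definition l2 : Type := {ffun I -> R[i]}.

HB.instance Definition _ := GRing.Lmodule.on l2.

Definition l2dot (u v : l2) : R[i] := \sum_i u i * Num.conj (v i).

Fact l2dot_bilinear : bilinear_for
  (GRing.Scale.Law.clone _ _ *%R _) (GRing.Scale.Law.clone _ _ (Num.conj \; *%R) _)
  l2dot.
Proof.
split=> [v|u] a x y /=.
  rewrite /l2dot mulr_sumr -big_split; apply: eq_bigr => i _ /=.
  by rewrite !ffunE /GRing.scale /= mulrDl mulrA.
rewrite /l2dot mulr_sumr -big_split; apply: eq_bigr => i _ /=.
rewrite !ffunE rmorphD rmorphM /= mulrDr; congr (_ + _); exact: mulrCA.
Qed.

HB.instance Definition _ := bilinear_isBilinear.Build R[i] l2 l2 R[i] _ _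
  l2dot l2dot_bilinear.

Fact l2dot_hermitian (u v : l2) :
  l2dot u v = (-1) ^+ false * Num.conj (l2dot v u).
Proof.
rewrite expr0 mul1r /l2dot rmorph_sum; apply: eq_bigr => i _.
by rewrite rmorphM /= Num.Theory.conjCK mulrC.
Qed.

HB.instance Definition _ := isHermitianSesquilinear.Build R[i] l2 false
  Num.conj l2dot l2dot_hermitian.

Fact l2dot_pos (u : l2) : u != 0 -> 0 < l2dot u u.
Proof.
move=> u0; rewrite lt0r sumr_ge0 ?andbT => [|i _]; last exact: mul_conjC_ge0.
apply: contra u0 => /eqP uu; apply/eqP/ffunP => i; rewrite !ffunE.
have := @psumr_eq0P _ _ xpredT (fun i => u i * Num.conj (u i)) _ uu i erefl.
by move=> /(_ (fun i _ => mul_conjC_ge0 (u i)))/eqP; rewrite mul_conjC_eq0 => /eqP.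
Qed.

HB.instance Definition _ := isDotProduct.Build R[i] l2 l2dot l2dot_pos.

HB.instance Definition _ := Lmodule_isNormed.Build R[i] l2
  (dot_nrmD l2dot) (dot_nrmZ l2dot) (@dot_nrm_eq0 _ _ l2dot).

Lemma l2normE (u : l2) : l2dot u u = `|u| ^+ 2.
Proof. by rewrite -sqr_dot_nrm. Qed.

Lemma l2norm_coord (u : l2) i : `|u i| <= `|u|.
Proof.
rewrite -(@ler_pXn2r _ 2) ?nnegrE ?normr_ge0 // -l2normE /l2dot (bigD1 i) //=.
rewrite normCK lerDl sumr_ge0 // => j _; exact: mul_conjC_ge0.
Qed.

Lemma l2norm_le_sum (u : l2) : `|u| <= \sum_i `|u i|.
Proof.
rewrite -(@ler_pXn2r _ 2) ?nnegrE ?normr_ge0 ?sumr_ge0 //.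
rewrite -l2normE /l2dot expr2 mulr_suml ler_sum // => i _.
rewrite -normCK expr2 ler_wpM2l // (bigD1 i) //= lerDl.
exact: sumr_ge0.
Qed.

Lemma normc_le_ReIm (z : R[i]) : `|z| <= (`|complex.Re z| + `|complex.Im z|)%:C.
Proof.
rewrite [z in `|z|]complexE (le_trans (ler_normD _ _)) // normrM.
by rewrite !normc_def /= !expr0n /= !expr1n ?addr0 ?add0r sqrtr1 mul1r !sqrtr_sqr rmorphD.
Qed.

Lemma normc_ge_Im (z : R[i]) : `|complex.Im z|%:C <= `|z|.
Proof.
rewrite -(sqrtr_sqr (complex.Im z)) normc_def lecR ler_wsqrtr //.
by rewrite lerDr sqr_ge0.
Qed.

(** The norm dominates every coordinate, so real and imaginary parts converge in [R] coordinate by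
    coordinate; the norm is in turn dominated by the sum of the coordinates, so the assembled vector
    is the limit. *)
Fact l2_complete (F : set_system l2) : ProperFilter F -> cauchy F -> cvg F.
Proof.
move=> FF /cauchy_ballP Fc.
have coordP (p : R[i] -> R) : (forall x y, p (x - y) = p x - p y) ->
    (forall z, `|p z|%:C <= `|z|) -> forall i, exists l : R,
    (fun u : l2 => p (u i)) @ F --> l.
  move=> pB pn i.
  suff : cvg ((fun u : l2 => p (u i)) @ F) by move=> c; eexists; exact: c.
  apply: R_complete; apply/cauchy_ballP => e e0.
  have e0' : 0 < e%:C by rewrite ltcR.
  have := Fc _ e0'; rewrite !near_simpl near_map2 => Fe.
  rewrite !near_simpl near_map2; apply: filterS Fe => -[u v] /=.
  rewrite -!ball_normE /= => uv.
  rewrite -ltcR (le_lt_trans _ uv) // -pB.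
  apply: le_trans (pn _) _.
  by rewrite (_ : u i - v i = (u - v) i) ?l2norm_coord // !ffunE.
have /choice[a ha] := coordP _ (raddfB (@complex.Re R)) (@normc_ge_Re R).
have /choice[b hb] := coordP _ (raddfB (@complex.Im R)) normc_ge_Im.
apply/cvg_ex; exists ([ffun i => a i +i* b i] : l2).
apply/cvgrPdist_lt => e e0.
have er : e = (complex.Re e)%:C by rewrite RRe_real // gtr0_real.
(* Each coordinate is off by less than [2 d], so the total is at most [Re e * #|I| / (#|I| + 1)];
   the added 1 makes this strictly less than [Re e] and covers an empty [I]. *)
pose d := complex.Re e / 2 / (#|I|%:R + 1).
have d0 : 0 < d.
  by rewrite !divr_gt0 // ?ltr_wpDl ?ler0n // -ltcR -er.
have H i : F [set u : l2 | `|a i - complex.Re (u i)| < d /\ `|b i - complex.Im (u i)| < d].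
  apply: filterI.
    by have /cvgrPdist_lt/(_ _ d0) := ha i.
  by have /cvgrPdist_lt/(_ _ d0) := hb i.
have := @filter_forall _ _ (fun i (u : l2) =>
  `|a i - complex.Re (u i)| < d /\ `|b i - complex.Im (u i)| < d) F FF H.
apply: filterS => u hu.
apply: le_lt_trans (l2norm_le_sum _) _.
apply: (@le_lt_trans _ _ (\sum_(i : I) (d + d)%:C)).
  apply: ler_sum => i _; rewrite !ffunE.
  apply: le_trans (normc_le_ReIm _) _.
  rewrite lecR; have [h1 h2] := hu i.
  by case: (u i) h1 h2 => x y /= h1 h2; rewrite lerD // ltW.
rewrite sumr_const -rmorphMn /= er ltcR.
have -> : (d + d) *+ #|I| = complex.Re e * (#|I|%:R / (#|I|%:R + 1)).
  rewrite -mulr_natr /d; field.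
  by rewrite gt_eqF // ltr_wpDl ?ler0n.
rewrite gtr_pMr ?ltr_pdivrMr ?mul1r ?ltrDl ?ltr_wpDl ?ler0n //.
by rewrite -ltcR -er.
Qed.

HB.instance Definition _ := Uniform_isComplete.Build l2 l2_complete.

Definition l2_hilbert : hilbertType R :=
  @HilbertType R l2 l2dot l2normE.

End EuclideanSpace.

(** * Matrices as operators on Euclidean spaces *)

Section EuclideanOperators.
Variables (R : realType) (I : finType).
Implicit Types (M N : I -> I -> R[i]).

Definition l2op M (u : l2 R I) : l2 R I := [ffun i => \sum_j M i j * u j].

Fact l2op_linear M : linear (l2op M).
Proof.
move=> a u v; apply/ffunP => i; rewrite !ffunE /GRing.scale /= mulr_sumr -big_split.
by apply: eq_bigr => j _; rewrite !ffunE /GRing.scale /= mulrDr mulrCA.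
Qed.

HB.instance Definition _ M :=
  GRing.isLinear.Build R[i] (l2 R I) (l2 R I) _ (l2op M) (l2op_linear M).

(** The sum of the moduli of all entries bounds the operator norm. *)
Lemma l2op_continuous M : continuous (l2op M).
Proof.
apply: bounded_linear_continuous; apply/linear_boundedP.
pose K := \sum_i \sum_j `|M i j|.
have K0 : 0 <= K by apply: sumr_ge0 => i _; apply: sumr_ge0.
near=> r => u; apply: (@le_trans _ _ (K * `|u|)); last first.
  by rewrite ler_wpM2r //; near: r; apply: nbhs_pinfty_ge; rewrite ger0_real.
apply: le_trans (l2norm_le_sum _) _; rewrite mulr_suml.
apply: ler_sum => i _; rewrite ffunE (le_trans (ler_norm_sum _ _ _)) // mulr_suml.
by apply: ler_sum => j _; rewrite normrM ler_wpM2l // l2norm_coord.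
Unshelve. all: by end_near. Qed.

Lemma l2op_comp M N u :
  l2op M (l2op N u) = l2op (fun i j => \sum_k M i k * N k j) u.
Proof.
apply/ffunP => i; rewrite !ffunE.
under eq_bigr do rewrite ffunE mulr_sumr.
rewrite exchange_big; apply: eq_bigr => j _; rewrite mulr_suml.
by apply: eq_bigr => k _; rewrite mulrA.
Qed.

Lemma eq_l2op M N : (forall i j, M i j = N i j) -> l2op M =1 l2op N.
Proof.
by move=> MN u; apply/ffunP => i; rewrite !ffunE; apply: eq_bigr => j _; rewrite MN.
Qed.

Lemma l2op1 u : l2op (fun i j => (i == j)%:R) u = u.
Proof.
apply/ffunP => i; rewrite ffunE (bigD1 i) //= eqxx mul1r big1 ?addr0 // => j ji.
by rewrite eq_sym (negPf ji) mul0r.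
Qed.

Lemma eigenproj_l2op M o (u : l2_hilbert R I) :
  eigenproj (l2op M : {linear l2_hilbert R I -> l2_hilbert R I}) o u =
  l2op (fun i j => ((i == j)%:R + (-1) ^+ o * M i j) / 2) u.
Proof.
rewrite /eigenproj -[u in u + _]l2op1; apply/ffunP => i.
rewrite !ffunE /GRing.scale /= !mulr_sumr -big_split mulr_sumr; apply: eq_bigr => j _ /=.
by rewrite mulrA -mulrDl mulrA [2^-1 * _]mulrC.
Qed.

Lemma l2op_hermitian M : (forall i j, M i j = Num.conj (M j i)) ->
  hermitian_op (l2op M : {linear l2_hilbert R I -> l2_hilbert R I}).
Proof.
move=> MH u v; rewrite /= /l2dot.
under eq_bigr do rewrite ffunE mulr_suml.
rewrite exchange_big; apply: eq_bigr => j _; rewrite ffunE rmorph_sum mulr_sumr.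
by apply: eq_bigr => i _; rewrite rmorphM /= -MH; ring.
Qed.

Lemma l2op_hermitian_unitary M : (forall i j, M i j = Num.conj (M j i)) ->
  (forall i j, \sum_k M i k * M k j = (i == j)%:R) ->
  hermitian_unitary (l2op M : {linear l2_hilbert R I -> l2_hilbert R I}).
Proof.
move=> MH M2; have MM u : l2op M (l2op M u) = u.
  by rewrite l2op_comp (eq_l2op M2) l2op1.
split; [exact: l2op_hermitian|split; first by exists (l2op M)].
by move=> u v; rewrite (l2op_hermitian MH) /= MM.
Qed.

End EuclideanOperators.

(** * Tensor products of Euclidean spaces *)

Section EuclideanTensor.
Variables (R : realType) (I J : finType).

Definition l2tens (u : l2_hilbert R I) (v : l2_hilbert R J)
  : l2_hilbert R (I * J)%type := [ffun p => u p.1 * v p.2] : l2 R (I * J)%type.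

Fact l2tens_bilinear : bilinear_for
  (GRing.Scale.Law.clone _ _ *:%R _) (GRing.Scale.Law.clone _ _ *:%R _) l2tens.
Proof.
split=> [v|u] a x y; apply/ffunP => p; rewrite !ffunE /GRing.scale /=.
  by rewrite mulrDl mulrA.
by rewrite mulrDr mulrCA.
Qed.

HB.instance Definition _ := bilinear_isBilinear.Build R[i] (l2_hilbert R I)
  (l2_hilbert R J) (l2_hilbert R (I * J)%type) _ _ l2tens l2tens_bilinear.

Fact dot_l2tens u1 v1 u2 v2 :
  dot (l2_hilbert R (I * J)%type) (l2tens u1 u2) (l2tens v1 v2) =
  dot (l2_hilbert R I) u1 v1 * dot (l2_hilbert R J) u2 v2.
Proof.
rewrite /= /l2dot big_distrlr pair_bigA; apply: eq_bigr => -[i j] _ /=.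
by rewrite !ffunE rmorphM /=; ring.
Qed.

Fact l2tens_dense : closure [set w : l2_hilbert R (I * J)%type |
  exists (n : nat) (u : 'I_n -> l2_hilbert R I) (v : 'I_n -> l2_hilbert R J),
    w = \sum_(i < n) l2tens (u i) (v i)] = setT.
Proof.
apply/seteqP; split=> // w _; apply: subset_closure.
(* Expansion in the canonical basis of pairs; the coefficient of [w] is carried by the second
   factor. *)
exists #|{: I * J}|, (fun k => [ffun i => (i == (enum_val k).1)%:R] : l2 R I),
  (fun k => [ffun j => (j == (enum_val k).2)%:R * w (enum_val k)] : l2 R J).
rewrite -(big_enum_val (A := {: I * J}) (fun p : I * J => l2tens
  ([ffun i => (i == p.1)%:R] : l2 R I) ([ffun j => (j == p.2)%:R * w p] : l2 R J))).
apply/ffunP => -[i j]; rewrite sum_ffunE (bigD1 (i, j)) //= !ffunE /= !eqxx !mul1r.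
rewrite big1 ?addr0 // => -[i' j'] /=; rewrite !ffunE /= mulrA -natrM mulnb.
by rewrite -xpair_eqE eq_sym => /negPf->; rewrite mul0r.
Qed.

Definition l2_tensor : hilbertTensor (l2_hilbert R I) (l2_hilbert R J) :=
  @HilbertTensor R (l2_hilbert R I) (l2_hilbert R J) (l2_hilbert R (I * J)%type)
    l2tens dot_l2tens l2tens_dense.

Lemma l2op_tensor (M : I -> I -> R[i]) (N : J -> J -> R[i]) T1 T2 :
  T1 =1 l2op M -> T2 =1 l2op N ->
  is_tensor_op (l2op (fun p q => M p.1 q.1 * N p.2 q.2)
                : {linear l2_tensor -> l2_tensor}) T1 T2.
Proof.
move=> T1M T2N; split; first exact: l2op_continuous.
move=> u v; rewrite T1M T2N; apply/ffunP => p; rewrite !ffunE big_distrlr pair_bigA.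
by apply: eq_bigr => -[i j] _ /=; rewrite !ffunE; ring.
Qed.

End EuclideanTensor.

(** * A Hilbert space as its own tensor product with a line, and the trivial Eve *)

Section ScalarTensor.
Variables (R : realType) (H : hilbertType R).

Definition scalar_tens (u : H) (z : l2_hilbert R 'I_1) : H := (z : l2 R 'I_1) ord0 *: u.

Fact scalar_tens_bilinear : bilinear_for
  (GRing.Scale.Law.clone _ _ *:%R _) (GRing.Scale.Law.clone _ _ *:%R _) scalar_tens.
Proof.
split=> [v|u] a x y; rewrite /scalar_tens.
  by rewrite scalerDr; congr (_ + _); rewrite scalerA mulrC -scalerA.
by rewrite !ffunE scalerDl -scalerA.
Qed.

HB.instance Definition _ := bilinear_isBilinear.Build R[i] H
  (l2_hilbert R 'I_1) H _ _ scalar_tens scalar_tens_bilinear.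

Fact dot_scalar_tens u1 v1 u2 v2 :
  dot H (scalar_tens u1 u2) (scalar_tens v1 v2) =
  dot H u1 v1 * dot (l2_hilbert R 'I_1) u2 v2.
Proof.
rewrite /scalar_tens linearZl_LR linearZr_LR /= /l2dot big_ord1.
by rewrite /GRing.scale /=; ring.
Qed.

Fact scalar_tens_dense : closure [set w : H |
  exists (n : nat) (u : 'I_n -> H) (v : 'I_n -> l2_hilbert R 'I_1),
    w = \sum_(i < n) scalar_tens (u i) (v i)] = setT.
Proof.
apply/seteqP; split=> // w _; apply: subset_closure.
exists 1, (fun=> w), (fun=> [ffun=> 1] : l2 R 'I_1).
by rewrite big_ord1 /scalar_tens ffunE scale1r.
Qed.

Definition scalar_tensor : hilbertTensor H (l2_hilbert R 'I_1) :=
  @HilbertTensor R H (l2_hilbert R 'I_1) H scalar_tens dot_scalar_tens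
    scalar_tens_dense.

End ScalarTensor.

(** Eve holds a one-dimensional system and always announces [(false, false)]. This shows that every
    sequential quantum correlation has at least one admissible extension. *)
Lemma sequential_quantum_trivialE (R : realType) (P : correlation R) :
  sequential_quantum P ->
  sequential_quantumE (fun a b e x y => (e == (false, false))%:R * P a b x y).
Proof.
case=> HA [HB [HAB [psi [A [B1 [B2 [psi1 obs PE]]]]]]].
exists HA, HB, (l2_hilbert R 'I_1), HAB, (scalar_tensor HAB), psi, A, B1, B2.
exists (fun e => l2op (fun i j => (e == (false, false))%:R) :
  {linear l2_hilbert R 'I_1 -> l2_hilbert R 'I_1}).
split=> //.
  split=> [e|e e' u|u].
  - by apply: l2op_hermitian => i j; rewrite rmorph_nat.
  - apply/ffunP => i; rewrite !ffunE !big_ord1 ffunE big_ord1.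
    have [<-|ee'] := eqVneq e e'.
      by case: (e == _); rewrite ?mul1r ?mul0r ffunE ?big_ord1 ?mul1r ?mul0r.
    rewrite ffunE; have [ee|_] := eqVneq e; last by rewrite mul0r.
    by rewrite -ee eq_sym (negPf ee') mul0r mulr0.
  - apply/ffunP => i; rewrite sum_ffunE (bigD1 (false, false)) //= ffunE big_ord1 mul1r.
    rewrite big1 ?addr0 ?(ord1 i) // => e /negPf e0; by rewrite ffunE big_ord1 e0 mul0r.
move=> a b e x y; have [T TT PT] := PE a b x y.
exists T, (((e == (false, false))%:R : R[i]) \*: T :
  {linear scalar_tensor HAB -> scalar_tensor HAB}).
split=> //.
  split=> [|u v]; first by move=> u; apply: cvgZr; apply: TT.1.
  rewrite /= /scalar_tens linearZ /= ffunE big_ord1 !scalerA; congr (_ *: _).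
by rewrite rmorphM /= PT rmorph_nat linearZl_LR.
Qed.

(** * Operators on tensor products *)

Lemma exists_linear (K : pzRingType) (U V : lmodType K) (f : U -> V) :
  linear f -> exists g : {linear U -> V}, g =1 f.
Proof.
move=> fL; pose m := GRing.isLinear.Build K U V *:%R f fL.
pose g : {linear U -> V} := HB.pack f m.
by exists g.
Qed.

Section DotTheory.
Variables (R : realType) (H : hilbertType R).
Implicit Types (u v w : H) (a : R[i]).

Lemma dotDl u v w : dot H (u + v) w = dot H u w + dot H v w.
Proof. exact: linearDl. Qed.

Lemma dotDr u v w : dot H u (v + w) = dot H u v + dot H u w.
Proof. exact: linearDr. Qed.

Lemma dotBl u v w : dot H (u - v) w = dot H u w - dot H v w.
Proof. exact: linearBl. Qed.

Lemma dotBr u v w : dot H u (v - w) = dot H u v - dot H u w.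
Proof. exact: linearBr. Qed.

Lemma dotNl u v : dot H (- u) v = - dot H u v.
Proof. exact: linearNl. Qed.

Lemma dotNr u v : dot H u (- v) = - dot H u v.
Proof. exact: linearNr. Qed.

Lemma dotZl a u v : dot H (a *: u) v = a * dot H u v.
Proof. exact: linearZl_LR. Qed.

Lemma dotZr a u v : dot H u (a *: v) = Num.conj a * dot H u v.
Proof. exact: linearZr_LR. Qed.

Lemma dotZr_real (x : R) u v : dot H u (x%:C *: v) = x%:C * dot H u v.
Proof. by rewrite dotZr conj_Creal // complex_real. Qed.

Lemma dot_suml (I : finType) (E : I -> H) v :
  dot H (\sum_i E i) v = \sum_i dot H (E i) v.
Proof. exact: linear_sumlz. Qed.

Lemma dot_sumr (I : finType) (E : I -> H) u :
  dot H u (\sum_i E i) = \sum_i dot H u (E i).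
Proof. exact: linear_sumr. Qed.

Lemma dot_eq0 u : dot H u u = 0 -> u = 0.
Proof. by move/eqP; rewrite dnorm_eq0 => /eqP. Qed.

End DotTheory.

Section Eigenproj.
Variables (R : realType) (H : hilbertType R) (T : {linear H -> H}).

Lemma eigenprojE o u : eigenproj T o u = 2^-1 *: (u + (-1) ^+ o *: T u).
Proof. by []. Qed.

Fact eigenproj_linear o : linear (eigenproj T o).
Proof.
move=> a u v; rewrite /eigenproj linearP (scalerA a) (mulrC a) -(scalerA _ a).
rewrite -scalerDr; congr (_ *: _).
by rewrite !scalerDr (scalerA _ a) (mulrC _ a) -(scalerA a) addrACA.
Qed.

HB.instance Definition _ o :=
  GRing.isLinear.Build R[i] H H _ (eigenproj T o) (eigenproj_linear o).

Lemma half_add (u : H) : 2^-1 *: (u + u) = u.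
Proof. by rewrite -mulr2n -[u *+ 2]scaler_nat scalerA mulVf ?scale1r // pnatr_eq0. Qed.

Lemma sum_eigenproj u : \sum_(o : bool) eigenproj T o u = u.
Proof.
rewrite big_bool /eigenproj /= expr0 expr1 scaleN1r scale1r -scalerDr.
by rewrite addrACA addNr addr0 half_add.
Qed.

Lemma sum1_eigenproj u : \sum_(o : bool) (1 : R[i]) *: eigenproj T o u = u.
Proof. by rewrite -[RHS]sum_eigenproj; apply: eq_bigr => o _; rewrite scale1r. Qed.

Lemma sum_sign_eigenproj u : \sum_(o : bool) (-1) ^+ o *: eigenproj T o u = T u.
Proof.
rewrite big_bool /eigenproj /= expr0 expr1 !scaleN1r !scale1r -scalerN -scalerDr.
by rewrite opprB addrA subrK half_add.
Qed.

Lemma eigenproj_comm (S : H -> H) o u : linear S ->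
  (forall v, S (T v) = T (S v)) -> S (eigenproj T o u) = eigenproj T o (S u).
Proof.
move=> /exists_linear[S' SS'] ST.
by rewrite /eigenproj -SS' linearZ linearD linearZ /= !SS' ST.
Qed.

Lemma dot_eigenproj o u v : hermitian_op T ->
  dot H (eigenproj T o u) v = dot H u (eigenproj T o v).
Proof.
move=> hT; rewrite /eigenproj !(linearZl_LR, linearZr_LR, linearDl, linearDr) /= hT.
rewrite rmorphV ?unitfE ?pnatr_eq0 // rmorph_nat rmorph_sign.
by rewrite /GRing.scale /=; ring.
Qed.

Lemma op_eigenproj o u : (forall v, T (T v) = v) ->
  T (eigenproj T o u) = (-1) ^+ o *: eigenproj T o u.
Proof.
move=> TT; rewrite /eigenproj linearZ_LR linearD linearZ_LR TT.
rewrite scalerA mulrC -scalerA; congr (_ *: _).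
by rewrite scalerDr scalerA -expr2 sqrr_sign scale1r addrC.
Qed.

Lemma eigenprojK o u : (forall v, T (T v) = v) ->
  eigenproj T o (eigenproj T o u) = eigenproj T o u.
Proof.
move=> TT; rewrite {1}/eigenproj op_eigenproj // scalerA -expr2 sqrr_sign.
by rewrite scale1r half_add.
Qed.

End Eigenproj.

Section TensorOperators.
Variables (R : realType) (H1 H2 : hilbertType R) (H : hilbertTensor H1 H2).

(** The set where [f] and [g] agree is closed, since [W] is Hausdorff, and contains the dense set of
    finite sums of tensors. *)
Lemma eq_on_tensors (W : normedModType R[i]) (f g : H -> W) :
  continuous f -> continuous g ->
  (forall (n : nat) (u : 'I_n -> H1) (v : 'I_n -> H2),
    f (\sum_(i < n) tens H (u i) (v i)) = g (\sum_(i < n) tens H (u i) (v i))) ->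
  f =1 g.
Proof.
move=> fc gc fg w; apply/subr0_eq.
have cl : closed ((fun w => f w - g w) @^-1` [set 0]).
  apply: preimage_closed; first by move=> x _; apply: cvgB; [exact: fc|exact: gc].
  exact/accessible_closed_set1/hausdorff_accessible/norm_hausdorff.
have : [set: H] w by [].
rewrite -(tens_dense H) => wcl.
rewrite -[_ = 0]/(((fun w => f w - g w) @^-1` [set 0]) w).
rewrite ((closure_id _).1 cl); apply: closureS wcl => _ /= [n [u [v ->]]].
by rewrite fg subrr.
Qed.

Lemma tensor_op_unique (S S' : {linear H -> H}) f f' g g' :
  is_tensor_op S f g -> is_tensor_op S' f' g' -> f =1 f' -> g =1 g' -> S =1 S'.
Proof.
move=> [Sc St] [S'c S't] ff' gg'; apply: eq_on_tensors => // n u v.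
by rewrite !linear_sum; apply: eq_bigr => i _; rewrite /= St S't ff' gg'.
Qed.

Lemma tensor_op_comp (S S' : {linear H -> H}) f f' g g' :
  is_tensor_op S f g -> is_tensor_op S' f' g' ->
  is_tensor_op (S \o S' : {linear H -> H}) (f \o f') (g \o g').
Proof.
move=> [Sc St] [S'c S't]; split.
  by move=> w; apply: continuous_comp; [exact: S'c|exact: Sc].
by move=> u v /=; rewrite S't St.
Qed.

Lemma tensor_op_id : is_tensor_op (idfun : {linear H -> H}) id id.
Proof. by split=> [w|//]; exact: cvg_id. Qed.

Lemma tensor_op_eigenproj (S : {linear H -> H}) o (T1 : {linear H1 -> H1}) :
  is_tensor_op S T1 id -> is_tensor_op (eigenproj S o) (eigenproj T1 o) id.
Proof.
move=> [Sc St]; split.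
  move=> w; apply: cvgZr; apply: cvgD; first exact: cvg_id.
  by apply: cvgZr; exact: Sc.
move=> u v; rewrite [LHS]eigenprojE St [in RHS]eigenprojE.
by rewrite !(linearZl_LR, linearDl).
Qed.

Lemma tensor_op_eigenprojr (S : {linear H -> H}) o (T2 : {linear H2 -> H2}) :
  is_tensor_op S id T2 -> is_tensor_op (eigenproj S o) id (eigenproj T2 o).
Proof.
move=> [Sc St]; split.
  move=> w; apply: cvgZr; apply: cvgD; first exact: cvg_id.
  by apply: cvgZr; exact: Sc.
move=> u v; rewrite [LHS]eigenprojE St [in RHS]eigenprojE.
by rewrite !(linearZr_LR, linearDr).
Qed.

Lemma dot_continuous (v : H) : continuous (fun w => dot H w v : R[i]^o).
Proof.
have [|f fE] := @exists_linear R[i] H R[i]^o (fun w => dot H w v).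
  by move=> a x y; rewrite linearPl.
rewrite -(_ : (f : H -> _) = (fun w => dot H w v)); last exact/funext.
apply: bounded_linear_continuous; apply/linear_boundedP.
near=> r => u; apply: (@le_trans _ _ (`|v| * `|u|)); last first.
  by rewrite ler_wpM2r //; near: r; apply: nbhs_pinfty_ge; rewrite ger0_real.
rewrite fE -(@ler_pXn2r _ 2) ?nnegrE ?mulr_ge0 ?normr_ge0 //.
by rewrite exprMn mulrC -!dot_norm; exact: dot_cauchy_schwarz.
Unshelve. all: by end_near. Qed.

(** The identity is clear on sums of tensors. Density extends it in one argument at a time; the
    second argument is reached by conjugating, as continuity of the form is available in the
    first. *)
Lemma tensor_op_hermitian (S : {linear H -> H}) (f : {linear H1 -> H1})
    (g : {linear H2 -> H2}) :
  is_tensor_op S f g -> hermitian_op f -> hermitian_op g -> hermitian_op S.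
Proof.
move=> [Sc St] hf hg.
have Ssum n (u : 'I_n -> H1) (v : 'I_n -> H2) :
    S (\sum_i tens H (u i) (v i)) = \sum_i tens H (f (u i)) (g (v i)).
  by rewrite linear_sum; apply: eq_bigr => i _; rewrite St.
have half n (u' : 'I_n -> H1) (v' : 'I_n -> H2) w : let t := \sum_i tens H (u' i) (v' i) in
    dot H (S w) t = dot H w (S t).
  move=> t; move: w; apply: (@eq_on_tensors R[i]^o).
  - move=> x; apply: (@continuous_comp _ _ _ S (fun w => dot H w t : R[i]^o)).
      exact: Sc.
    exact: dot_continuous.
  - exact: dot_continuous.
  move=> m u v; rewrite !Ssum !dot_suml.
  apply: eq_bigr => i _; rewrite !dot_sumr.
  by apply: eq_bigr => j _; rewrite !dot_tens hf hg.
move=> u v; rewrite [LHS]dot_conj [RHS]dot_conj; congr Num.conj; apply/esym.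
move: v; apply: (@eq_on_tensors R[i]^o).
- move=> x; apply: (@continuous_comp _ _ _ S (fun w => dot H w u : R[i]^o)).
    exact: Sc.
  exact: dot_continuous.
- exact: dot_continuous.
by move=> n u' v'; rewrite [LHS]dot_conj [RHS]dot_conj half.
Qed.

(** A way to obtain a product operator without an extension theorem: if [F] and [G] are combinations
    of maps whose products are already given, the same combination of those products represents the
    pair. *)
Lemma tensor_op_sum (I J : finType) (c : I -> R[i]) (d : J -> R[i])
    (S : I -> J -> {linear H -> H}) (f : I -> H1 -> H1) (g : J -> H2 -> H2) F G :
  (forall i j, is_tensor_op (S i j) (f i) (g j)) ->
  (forall u, \sum_i c i *: f i u = F u) ->
  (forall v, \sum_j d j *: g j v = G v) ->
  exists2 T : {linear H -> H}, is_tensor_op T F G &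
    forall w, T w = \sum_(p : I * J) (c p.1 * d p.2) *: S p.1 p.2 w.
Proof.
move=> Sfg cF dG.
have [|T TE] := @exists_linear _ _ _
    (fun w => \sum_(p : I * J) (c p.1 * d p.2) *: S p.1 p.2 w).
  move=> a u v; rewrite scaler_sumr -big_split; apply: eq_bigr => i _ /=.
  by rewrite linearP scalerDr !scalerA mulrC.
exists T; last exact: TE.
split.
  rewrite (_ : (T : H -> H) = \sum_(p : I * J) (fun w => (c p.1 * d p.2) *: S p.1 p.2 w)); last first.
    by apply/funext => w; rewrite TE fct_sumE.
  elim/big_ind: _ => [|h k hc kc|i _] x.
  - exact: cvg_cst.
  - by apply: cvgD; [exact: hc|exact: kc].
  - by apply: cvgZr; exact: (Sfg i.1 i.2).1.
move=> u v; rewrite TE -cF -dG linear_sumlz.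
under [RHS]eq_bigr do rewrite linear_sumr.
rewrite pair_bigA; apply: eq_bigr => -[i j] _ /=.
by rewrite (Sfg i j).2 linearZl_LR linearZr_LR scalerA.
Qed.

Lemma eq_tensor_op (S : {linear H -> H}) f f' g g' :
  f =1 f' -> g =1 g' -> is_tensor_op S f g -> is_tensor_op S f' g'.
Proof. by move=> ff' gg' [Sc St]; split=> // u v; rewrite St ff' gg'. Qed.

End TensorOperators.

Lemma hermitian_unitaryK (R : realType) (H : hilbertType R) (T : {linear H -> H}) :
  hermitian_unitary T -> forall u, T (T u) = u.
Proof.
move=> [hT [_ uT]] u; apply/subr0_eq/dot_eq0.
by rewrite dotBl hT uT subrr.
Qed.

Lemma sum_pair_comp (R : realType) (H : hilbertType R) (I J : finType)
    (c : I -> R[i]) (d : J -> R[i]) (f : I -> {linear H -> H}) (g : J -> H -> H) F G :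
  (forall u, \sum_i c i *: f i u = F u) -> (forall u, \sum_j d j *: g j u = G u) ->
  forall u, \sum_(p : I * J) (c p.1 * d p.2) *: f p.1 (g p.2 u) = F (G u).
Proof.
move=> cF dG u; rewrite -cF -dG.
under [RHS]eq_bigr do rewrite linear_sum scaler_sumr.
rewrite [RHS]pair_bigA; apply: eq_bigr => -[i j] _ /=.
by rewrite linearZ scalerA.
Qed.

(** * From tensor products to commuting operators *)

(* Tensoring with identities turns a sequential quantum realization into
   commuting operators on a single Hilbert space. *)
Record joint_model (R : realType) (Q : correlationE R) (H : hilbertType R) (psi : H)
    (A : bool -> {linear H -> H}) (B1 : bool -> {linear H -> H})
    (B2 : bool -> bool -> {linear H -> H}) (E : bool * bool -> {linear H -> H})
    : Prop := JointModel {
  jm_norm : dot H psi psi = 1;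
  jm_hermA : forall x, hermitian_op (A x);
  jm_hermB1 : forall y1, hermitian_op (B1 y1);
  jm_hermB2 : forall y1 y2, hermitian_op (B2 y1 y2);
  jm_hermE : forall e, hermitian_op (E e);
  jm_AK : forall x u, A x (A x u) = u;
  jm_B1K : forall y1 u, B1 y1 (B1 y1 u) = u;
  jm_B2K : forall y1 y2 u, B2 y1 y2 (B2 y1 y2 u) = u;
  jm_EE : forall e e' u, E e (E e' u) = if e == e' then E e u else 0;
  jm_sumE : forall u, \sum_e E e u = u;
  jm_AB1 : forall x y1 u, A x (B1 y1 u) = B1 y1 (A x u);
  jm_AB2 : forall x y1 y2 u, A x (B2 y1 y2 u) = B2 y1 y2 (A x u);
  jm_B12 : forall y1 y2 u, B1 y1 (B2 y1 y2 u) = B2 y1 y2 (B1 y1 u);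
  jm_EA : forall e x u, E e (A x u) = A x (E e u);
  jm_EB1 : forall e y1 u, E e (B1 y1 u) = B1 y1 (E e u);
  jm_EB2 : forall e y1 y2 u, E e (B2 y1 y2 u) = B2 y1 y2 (E e u);
  jm_Q : forall a b e x y, (Q a b e x y)%:C =
    dot H (E e (eigenproj (A x) a (eigenproj (B1 y.1) b.1
      (eigenproj (B2 y.1 y.2) b.2 psi)))) psi }.

Section TensorOperatorAlgebra.
Variables (R : realType) (H1 H2 : hilbertType R) (H : hilbertTensor H1 H2).

Lemma tensor_op_comm (S S' : {linear H -> H}) (f f' : H1 -> H1) (g g' : H2 -> H2) :
  is_tensor_op S f g -> is_tensor_op S' f' g' ->
  (forall u, f (f' u) = f' (f u)) -> (forall u, g (g' u) = g' (g u)) ->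
  forall w, S (S' w) = S' (S w).
Proof.
move=> Sfg S'fg ff gg w.
exact: (tensor_op_unique (tensor_op_comp Sfg S'fg) (tensor_op_comp S'fg Sfg) ff gg w).
Qed.

Lemma tensor_op_involutive (S : {linear H -> H}) (f : H1 -> H1) (g : H2 -> H2) :
  is_tensor_op S f g -> (forall u, f (f u) = u) -> (forall u, g (g u) = u) ->
  forall w, S (S w) = w.
Proof.
move=> Sfg ff gg w.
exact: (tensor_op_unique (tensor_op_comp Sfg Sfg) (tensor_op_id H) ff gg w).
Qed.

End TensorOperatorAlgebra.

Lemma id_hermitian (R : realType) (H : hilbertType R) :
  hermitian_op (idfun : {linear H -> H}).
Proof. by []. Qed.

(** * Recovering the observables from the joint projections *)

Section JointProjections.
Variables (R : realType) (HA HB : hilbertType R) (HAB : hilbertTensor HA HB).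
Variables (A : bool -> {linear HA -> HA}) (B1 : bool -> {linear HB -> HB}).
Variable (B2 : bool -> bool -> {linear HB -> HB}).
Variable (T : bool * (bool * bool) -> bool -> bool * bool -> {linear HAB -> HAB}).
Hypothesis HT : forall i a b, is_tensor_op (T i a b) (eigenproj (A i.1) a)
  (eigenproj (B1 i.2.1) b.1 \o eigenproj (B2 i.2.1 i.2.2) b.2).

(** A sign on the outcome that is kept and weight 1 on those that are summed out turn the joint
    projections into an observable tensored with the identity. *)
Lemma exists_tensor_A x i : i.1 = x -> exists2 S : {linear HAB -> HAB},
  is_tensor_op S (A x) id &
  forall w, S w = \sum_(o : bool * (bool * bool)) ((-1) ^+ o.1 * (1 * 1)) *: T i o.1 o.2 w.
Proof.
move=> ix; apply: (tensor_op_sum (c := fun a : bool => (-1) ^+ a)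
  (d := fun b : bool * bool => 1 * 1) (HT i)) => [u|v] /=.
  by rewrite sum_sign_eigenproj ix.
exact: (sum_pair_comp (sum1_eigenproj _) (sum1_eigenproj _)).
Qed.

Lemma exists_tensor_B1 y1 i : i.2.1 = y1 -> exists2 S : {linear HAB -> HAB},
  is_tensor_op S id (B1 y1) &
  forall w, S w = \sum_(o : bool * (bool * bool)) (1 * ((-1) ^+ o.2.1 * 1)) *: T i o.1 o.2 w.
Proof.
move=> iy; apply: (tensor_op_sum (c := fun a : bool => 1)
  (d := fun b : bool * bool => (-1) ^+ b.1 * 1) (HT i)) => [u|v] /=.
  exact: sum1_eigenproj.
rewrite (sum_pair_comp (sum_sign_eigenproj _) (sum1_eigenproj _)).
by rewrite iy.
Qed.

Lemma exists_tensor_B2 y1 y2 i : i.2 = (y1, y2) -> exists2 S : {linear HAB -> HAB},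
  is_tensor_op S id (B2 y1 y2) &
  forall w, S w = \sum_(o : bool * (bool * bool)) (1 * (1 * (-1) ^+ o.2.2)) *: T i o.1 o.2 w.
Proof.
move=> iy; apply: (tensor_op_sum (c := fun a : bool => 1)
  (d := fun b : bool * bool => 1 * (-1) ^+ b.2) (HT i)) => [u|v] /=.
  exact: sum1_eigenproj.
rewrite (sum_pair_comp (sum1_eigenproj _) (sum_sign_eigenproj _)).
by rewrite iy.
Qed.

Lemma sum_joint_projections i w : \sum_o T i o.1 o.2 w = w.
Proof.
have [||S HS SE] := tensor_op_sum (c := fun a : bool => 1)
  (d := fun b : bool * bool => 1 * 1) (HT i) (F := id) (G := id).
- exact: sum1_eigenproj.
- exact: (sum_pair_comp (sum1_eigenproj _) (sum1_eigenproj _)).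
rewrite -[RHS](tensor_op_unique HS (tensor_op_id HAB) (frefl _) (frefl _) w) SE.
by apply: eq_bigr => -[a b] _; rewrite !mulr1 scale1r.
Qed.

End JointProjections.

(** Observables are rebuilt by signed sums on [HAB] and lifted to [HABE]; each required relation
    holds on the factors and passes to the product because a continuous operator is determined by
    its values on tensors. *)
Lemma sequential_quantumE_model (R : realType) (Q : correlationE R) :
  sequential_quantumE Q -> exists (H : hilbertType R) (psi : H) A B1 B2 E,
  joint_model Q psi A B1 B2 E.
Proof.
case=> HA [HB [HE [HAB [HABE [psi [A [B1 [B2 [E [psi1 [hA hB1 hB2 B12] [hE EE sumE] QE]]]]]]]]]].
have /choice[T' /= HT'] : forall j : (bool * (bool * bool)) * (bool * (bool * bool)),
    exists S : {linear HAB -> HAB}, is_tensor_op S (eigenproj (A j.1.1) j.2.1)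
  (eigenproj (B1 j.1.2.1) j.2.2.1 \o eigenproj (B2 j.1.2.1 j.1.2.2) j.2.2.2).
  by move=> [[x y] [a b]]; have [S [_ [HS _ _]]] := QE a b (false, false) x y; exists S.
pose T i a b := T' (i, (a, b)).
have HT i a b : is_tensor_op (T i a b) (eigenproj (A i.1) a)
  (eigenproj (B1 i.2.1) b.1 \o eigenproj (B2 i.2.1 i.2.2) b.2) := HT' (i, (a, b)).
(* The realization may name a different operator on [HAB] for each outcome of Eve; uniqueness
   identifies them all with the chosen [T]. *)
have QU a b e x y : exists2 U : {linear HABE -> HABE}, is_tensor_op U (T (x, y) a b) (E e) &
    (Q a b e x y)%:C = dot HABE (U psi) psi.
  have [S [U [HS HU QU]]] := QE a b e x y; exists U => //.
  apply: eq_tensor_op HU => // w.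
  exact: (tensor_op_unique HS (HT (x, y) a b) (frefl _) (frefl _)).
have /choice[U' /= HU'] : forall j : (bool * (bool * bool)) * (bool * (bool * bool)) * (bool * bool),
    exists S : {linear HABE -> HABE}, is_tensor_op S (T j.1.1 j.1.2.1 j.1.2.2) (E j.2).
  by move=> [[[x y] [a b]] e]; have [S] := QU a b e x y; exists S.
pose U i o e := U' (i, o, e).
have HU i o e : is_tensor_op (U i o e) (T i o.1 o.2) (E e) := HU' (i, o, e).
have sum1E v : \sum_e (1 : R[i]) *: E e v = v.
  by rewrite -[RHS]sumE; apply: eq_bigr => e _; rewrite scale1r.
(* Weight 1 on every outcome of Eve puts the identity on her side. *)
have lift i (c : bool * (bool * bool) -> R[i]) (S : {linear HAB -> HAB}) :
    (forall w, S w = \sum_o c o *: T i o.1 o.2 w) ->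
    exists S' : {linear HABE -> HABE}, is_tensor_op S' S id.
  move=> SE; have [|S' HS' _] :=
    tensor_op_sum (c := c) (d := fun e : bool * bool => 1) (HU i) _ sum1E (F := S).
    by move=> w; rewrite SE.
  by exists S'.
have /choice[A' HA'] : forall x, exists S : {linear HAB -> HAB} * {linear HABE -> HABE},
    is_tensor_op S.1 (A x) id /\ is_tensor_op S.2 S.1 id.
  move=> x; have [S HS SE] := exists_tensor_A HT (erefl : (x, (false, false)).1 = x).
  by have [S' HS'] := lift _ _ _ SE; exists (S, S').
have /choice[B1' HB1'] : forall y1, exists S : {linear HAB -> HAB} * {linear HABE -> HABE},
    is_tensor_op S.1 id (B1 y1) /\ is_tensor_op S.2 S.1 id.
  move=> y1; have [S HS SE] := exists_tensor_B1 HT (erefl : (false, (y1, false)).2.1 = y1).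
  by have [S' HS'] := lift _ _ _ SE; exists (S, S').
have /choice[B2' HB2'] : forall y : bool * bool, exists S : {linear HAB -> HAB} * {linear HABE -> HABE},
    is_tensor_op S.1 id (B2 y.1 y.2) /\ is_tensor_op S.2 S.1 id.
  move=> y; have [S HS SE] := exists_tensor_B2 HT
    (etrans (erefl : (false, y).2 = y) (surjective_pairing y)).
  by have [S' HS'] := lift _ _ _ SE; exists (S, S').
(* Conversely, summing all outcomes of Alice and Bob at one fixed input leaves the identity on
   [HAB], and a Kronecker weight selects Eve's projector. *)
have /choice[E' HE'] : forall e, exists S : {linear HABE -> HABE}, is_tensor_op S id (E e).
  move=> e; have [||S HS _] := tensor_op_sum (c := fun=> 1) (d := fun e' : bool * bool => (e' == e)%:R)
    (HU (false, (false, false))) (F := id) (G := E e).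
  - move=> w; rewrite -[RHS](sum_joint_projections HT (false, (false, false))).
    by apply: eq_bigr => o _; rewrite scale1r.
  - move=> w; rewrite (bigD1 e) //= eqxx scale1r big1 ?addr0 // => e' /negPf ->.
    by rewrite scale0r.
  by exists S.
have AK x := hermitian_unitaryK (hA x); have B1K y := hermitian_unitaryK (hB1 y).
have B2K y1 y2 := hermitian_unitaryK (hB2 y1 y2).
exists HABE, psi, (fun x => (A' x).2), (fun y => (B1' y).2),
  (fun y1 y2 => (B2' (y1, y2)).2), E'.
have hA' x : hermitian_op (A' x).1.
  by apply: (tensor_op_hermitian (g := idfun) (HA' x).1 (hA x).1); exact: id_hermitian.
have hB1' y : hermitian_op (B1' y).1.
  by apply: (tensor_op_hermitian (f := idfun) (HB1' y).1 _ (hB1 y).1); exact: id_hermitian.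
have hB2' y : hermitian_op (B2' y).1.
  by apply: (tensor_op_hermitian (f := idfun) (HB2' y).1 _ (hB2 y.1 y.2).1); exact: id_hermitian.
split.
- by rewrite dot_norm psi1 expr1n.
- by move=> x; apply: (tensor_op_hermitian (g := idfun) (HA' x).2 (hA' x)); exact: id_hermitian.
- by move=> y; apply: (tensor_op_hermitian (g := idfun) (HB1' y).2 (hB1' y)); exact: id_hermitian.
- by move=> y1 y2; apply: (tensor_op_hermitian (g := idfun) (HB2' (y1, y2)).2 (hB2' _)); exact: id_hermitian.
- by move=> e; apply: (tensor_op_hermitian (f := idfun) (HE' e) _ (hE e)); exact: id_hermitian.
- move=> x; apply: (tensor_op_involutive (HA' x).2) => // w.
  exact: (tensor_op_involutive (HA' x).1 (AK x)).
- move=> y; apply: (tensor_op_involutive (HB1' y).2) => // w.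
  exact: (tensor_op_involutive (HB1' y).1 _ (B1K y)).
- move=> y1 y2; apply: (tensor_op_involutive (HB2' (y1, y2)).2) => // w.
  exact: (tensor_op_involutive (HB2' (y1, y2)).1 _ (B2K y1 y2)).
- move=> e e' u; have HEE := tensor_op_comp (HE' e) (HE' e').
  have [ee'|ee'] := eqVneq e e'.
    have EEe : E e \o E e' =1 E e by move=> v /=; rewrite EE ee' eqxx.
    exact: (tensor_op_unique HEE (HE' e) (frefl _) EEe u).
  have H0 : is_tensor_op (\0 : {linear HABE -> HABE}) id (\0 : HE -> HE).
    by split=> [w|w v]; [exact: cvg_cst|rewrite linear0r].
  have EEe : E e \o E e' =1 \0 by move=> v /=; rewrite EE (negPf ee').
  exact: (tensor_op_unique HEE H0 (frefl _) EEe u).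
- move=> u.
  have [|S HS SE] := tensor_op_sum (c := fun _ : 'I_1 => 1)
     (d := fun e' : bool * bool => 1) (fun=> HE') (F := id) _ sum1E.
    by move=> w; rewrite big_ord1 scale1r.
  rewrite -[RHS](tensor_op_unique HS (tensor_op_id HABE) (frefl _) (frefl _) u) SE.
  rewrite -(pair_bigA _ (fun i e => (1 * 1) *: E' e u)) big_ord1.
  by apply: eq_bigr => e _; rewrite mulr1 scale1r.
- move=> x y u; apply: (tensor_op_comm (HA' x).2 (HB1' y).2) => // w.
  exact: (tensor_op_comm (HA' x).1 (HB1' y).1).
- move=> x y1 y2 u; apply: (tensor_op_comm (HA' x).2 (HB2' (y1, y2)).2) => // w.
  exact: (tensor_op_comm (HA' x).1 (HB2' (y1, y2)).1).
- move=> y1 y2 u; apply: (tensor_op_comm (HB1' y1).2 (HB2' (y1, y2)).2) => // w.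
  exact: (tensor_op_comm (HB1' y1).1 (HB2' (y1, y2)).1).
- by move=> e x u; apply: (tensor_op_comm (HE' e) (HA' x).2).
- by move=> e y u; apply: (tensor_op_comm (HE' e) (HB1' y).2).
- by move=> e y1 y2 u; apply: (tensor_op_comm (HE' e) (HB2' (y1, y2)).2).
move=> a b e x y; have [V HV ->] := QU a b e x y; congr (dot _ _ _).
have HR := tensor_op_comp (HE' e) (tensor_op_comp (tensor_op_eigenproj a (HA' x).2)
  (tensor_op_comp (tensor_op_eigenproj b.1 (HB1' y.1).2)
     (tensor_op_eigenproj b.2 (HB2' (y.1, y.2)).2))).
apply: (tensor_op_unique HV HR) => // w.
have HR' := tensor_op_comp (tensor_op_eigenproj a (HA' x).1)
  (tensor_op_comp (tensor_op_eigenprojr b.1 (HB1' y.1).1)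
     (tensor_op_eigenprojr b.2 (HB2' (y.1, y.2)).1)).
exact: (tensor_op_unique (HT (x, y) a b) HR').
Qed.

(** * Alice's directions and steering *)

Lemma dot_ext (R : realType) (H : hilbertType R) (u v : H) :
  (forall w, dot H u w = dot H v w) -> u = v.
Proof. by move=> uv; apply/subr0_eq/dot_eq0; rewrite dotBl uv subrr. Qed.

Lemma opD (R : realType) (H : hilbertType R) (S : {linear H -> H}) u v :
  S (u + v) = S u + S v.
Proof. exact: linearD. Qed.

Lemma opZ (R : realType) (H : hilbertType R) (S : {linear H -> H}) a u :
  S (a *: u) = a *: S u.
Proof. exact: linearZ_LR. Qed.

Section Moments.
Variables (R : realType) (P : correlation R) (Q : correlationE R).
Variables (H : hilbertType R) (psi : H).
Variables (A : bool -> {linear H -> H}) (B1 : bool -> {linear H -> H}).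
Variables (B2 : bool -> bool -> {linear H -> H}) (E : bool * bool -> {linear H -> H}).
Hypothesis PQ : extends_correlation P Q.
Hypothesis M : joint_model Q psi A B1 B2 E.

Lemma correlation_model a b x y : (P a b x y)%:C =
  dot H (eigenproj (A x) a (eigenproj (B1 y.1) b.1 (eigenproj (B2 y.1 y.2) b.2 psi))) psi.
Proof.
rewrite -PQ rmorph_sum /=; under eq_bigr do rewrite (jm_Q M).
by rewrite -dot_suml (jm_sumE M).
Qed.

Lemma mean_AB1_model x y1 :
  (mean_AB1 P x y1)%:C = dot H (A x (B1 y1 psi)) psi.
Proof.
rewrite -(sum_pair_comp (sum_sign_eigenproj (A x)) (sum_pair_comp
  (sum_sign_eigenproj (B1 y1)) (sum1_eigenproj (B2 y1 false)))).
rewrite dot_suml /mean_AB1 pair_bigA rmorph_sum; apply: eq_bigr => -[a b] _ /=.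
by rewrite !rmorphM /= !rmorph_sign correlation_model dotZl mulr1.
Qed.

Lemma mean_AB2_model x y1 y2 :
  (mean_AB2 P x y1 y2)%:C = dot H (A x (B2 y1 y2 psi)) psi.
Proof.
rewrite -(sum_pair_comp (sum_sign_eigenproj (A x)) (sum_pair_comp
  (sum1_eigenproj (B1 y1)) (sum_sign_eigenproj (B2 y1 y2)))).
rewrite dot_suml /mean_AB2 pair_bigA rmorph_sum; apply: eq_bigr => -[a b] _ /=.
by rewrite !rmorphM /= !rmorph_sign correlation_model dotZl mul1r.
Qed.

End Moments.

Section AliceDirections.
Variables (R : realType) (H : hilbertType R) (A : bool -> {linear H -> H}).
Hypothesis hA : forall x, hermitian_op (A x).
Hypothesis AK : forall x u, A x (A x u) = u.

Let r : R[i] := (Num.sqrt 2)%:C.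

Lemma sqrt2C_sqr : ((Num.sqrt 2 : R)%:C) ^+ 2 = 2.
Proof. by rewrite -rmorphXn /= sqr_sqrtr ?ler0n // rmorph_nat. Qed.

Lemma sqrt2C_neq0 : (Num.sqrt 2 : R)%:C != 0.
Proof. by rewrite -sqrf_eq0 sqrt2C_sqr pnatr_eq0. Qed.

Let rV2 : r^-1 * r^-1 = 2^-1.
Proof. by rewrite -invfM -expr2 sqrt2C_sqr. Qed.

(* For anticommuting A_0 and A_1 these are Alice's Pauli observables Z and X. *)
Definition alice_dir (b : bool) (u : H) : H :=
  locked (r^-1 *: (A false u + (-1) ^+ b *: A true u)).

Lemma alice_dirE b u : alice_dir b u = r^-1 *: (A false u + (-1) ^+ b *: A true u).
Proof. by rewrite /alice_dir -lock. Qed.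

Fact alice_dir_linear b : linear (alice_dir b).
Proof.
move=> a u v; apply: dot_ext => w; rewrite !alice_dirE !linearP.
by rewrite !(dotDl, dotZl); ring.
Qed.

HB.instance Definition _ b :=
  GRing.isLinear.Build R[i] H H _ (alice_dir b) (alice_dir_linear b).

Lemma alice_dir_hermitian b : hermitian_op (alice_dir b).
Proof.
have rVc : Num.conj r^-1 = r^-1 by rewrite conj_Creal // rpredV complex_real.
move=> u v; rewrite /= !alice_dirE dotZl dotZr rVc !(dotDl, dotDr) dotZl dotZr.
by rewrite rmorph_sign !hA.
Qed.

Lemma alice_dir_comm b (S : {linear H -> H}) u :
  (forall x v, A x (S v) = S (A x v)) -> alice_dir b (S u) = S (alice_dir b u).
Proof.
by move=> AS; rewrite !alice_dirE !AS (opZ S) (opD S) (opZ S).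
Qed.

Lemma alice_dir_comp b c u : alice_dir b (alice_dir c u) =
  2^-1 *: ((1 + (-1) ^+ b * (-1) ^+ c) *: u + ((-1) ^+ c *: A false (A true u) +
    (-1) ^+ b *: A true (A false u))).
Proof.
rewrite -rV2 !alice_dirE !(opZ (A _)) !(opD (A _)) !(opZ (A _)) !AK.
by apply: dot_ext => w; rewrite !(dotDl, dotZl); ring.
Qed.

(** For any two involutions [(A_0 + A_1)(A_0 - A_1) = A_1 A_0 - A_0 A_1], which changes sign when
    the factors are exchanged; no assumption on the state enters. *)
Lemma alice_dir_anticomm b u :
  alice_dir b (alice_dir (~~ b) u) = - alice_dir (~~ b) (alice_dir b u).
Proof.
rewrite !alice_dir_comp; apply: dot_ext => w; rewrite dotNl !(dotDl, dotZl).
by case: b; rewrite /= !(expr0, expr1); ring.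
Qed.

Lemma alice_dir_sqr_sum u :
  alice_dir false (alice_dir false u) + alice_dir true (alice_dir true u) = 2 *: u.
Proof.
rewrite !alice_dir_comp; apply: dot_ext => w; rewrite !(dotDl, dotZl).
by rewrite /= !(expr0, expr1); field.
Qed.

Lemma alice_from_dir x u :
  A x u = r^-1 *: (alice_dir false u + (-1) ^+ x *: alice_dir true u).
Proof.
rewrite !alice_dirE expr0 expr1; apply: dot_ext => w; rewrite !(dotDl, dotZl).
transitivity (r^-1 * r^-1 * (dot H (A false u) w + dot H (A true u) w +
  (-1) ^+ x * (dot H (A false u) w - dot H (A true u) w))); last by ring.
by rewrite rV2; case: x; rewrite ?expr0 ?expr1; field.
Qed.

End AliceDirections.

(** * Consequences of the two maximal CHSH values *)

Section Steering.
Variables (R : realType) (Q : correlationE R) (H : hilbertType R) (psi : H).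
Variables (A : bool -> {linear H -> H}) (B1 : bool -> {linear H -> H}).
Variables (B2 : bool -> bool -> {linear H -> H}) (E : bool * bool -> {linear H -> H}).
Hypothesis M : joint_model Q psi A B1 B2 E.

Local Notation D := (alice_dir A).
Local Notation r := ((Num.sqrt 2 : R)%:C).

Let hD b u v : dot H (D b u) v = dot H u (D b v) :=
  alice_dir_hermitian (jm_hermA M) b u v.
Let DDN b u : D b (D (~~ b) u) = - D (~~ b) (D b u) := alice_dir_anticomm (jm_AK M) b u.

Lemma dirZ b a u : D b (a *: u) = a *: D b u.
Proof. exact: linearZ_LR. Qed.

Lemma dirD b u v : D b (u + v) = D b u + D b v.
Proof. exact: linearD. Qed.

Lemma dirN b u : D b (- u) = - D b u.
Proof. by rewrite -scaleN1r dirZ scaleN1r. Qed.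

Lemma dir_B1 b y u : D b (B1 y u) = B1 y (D b u).
Proof. by apply: alice_dir_comm => x v; rewrite (jm_AB1 M). Qed.

Lemma dir_B2 b y1 y2 u : D b (B2 y1 y2 u) = B2 y1 y2 (D b u).
Proof. by apply: alice_dir_comm => x v; rewrite (jm_AB2 M). Qed.

Lemma dir_E b e u : D b (E e u) = E e (D b u).
Proof. by apply: alice_dir_comm => x v; rewrite (jm_EA M). Qed.

(** A property of an arbitrary vector, since it is needed for psi and for Eve's unnormalised
    conditional vectors alike. *)
Definition steered (phi : H) : Prop :=
  D false phi = B2 false false phi /\ D true phi = B1 true phi.

(* [2 - <S_c> / sqrt 2] is half the sum of the squared distances between both sides
   of the two steering equations. *)
Lemma max_Sc_steered (P : correlation R) : extends_correlation P Q ->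
  mean_Sc P = 2 * Num.sqrt 2 -> steered psi.
Proof.
move=> PQ /(congr1 (real_complex R)).
rewrite /mean_Sc; rewrite !(rmorphD, rmorphN, rmorphM, rmorph1) /= !(mean_AB1_model PQ M, mean_AB2_model PQ M).
set u := B2 false false psi; set v := B1 true psi => Sc.
have dd : dot H (D false u) psi + dot H (D true v) psi = 2.
  apply: (mulfI (sqrt2C_neq0 R)); rewrite [RHS]mulrC -Sc !alice_dirE.
  rewrite !(dotDl, dotZl) expr0 expr1.
  by field; exact: sqrt2C_neq0.
have uu : dot H u u = 1.
  by rewrite -(jm_norm M) /u (jm_hermB2 M) (jm_B2K M).
have vv : dot H v v = 1.
  by rewrite -(jm_norm M) /v (jm_hermB1 M) (jm_B1K M).
have Du : dot H u (D false psi) = dot H (D false u) psi by rewrite (hD false).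
have Dv : dot H v (D true psi) = dot H (D true v) psi by rewrite (hD true).
have uD : dot H (D false psi) u = dot H (D false u) psi.
  by rewrite /u -(jm_hermB2 M) dir_B2.
have vD : dot H (D true psi) v = dot H (D true v) psi.
  by rewrite /v -(jm_hermB1 M) dir_B1.
have DD : dot H (D false psi) (D false psi) + dot H (D true psi) (D true psi) = 2.
  by rewrite !hD -dotDr (alice_dir_sqr_sum (jm_AK M)) dotZr rmorph_nat (jm_norm M) mulr1.
have : dot H (D false psi - u) (D false psi - u) +
    dot H (D true psi - v) (D true psi - v) = 0.
  rewrite !(dotBl, dotBr) uu vv Du Dv uD vD.
  transitivity (dot H (D false psi) (D false psi) + dot H (D true psi) (D true psi)
    + 2 - 2 * (dot H (D false u) psi + dot H (D true v) psi)); first by ring.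
  by rewrite DD dd; ring.
move/eqP; rewrite paddr_eq0 ?dnorm_ge0 // !dnorm_eq0 !subr_eq0.
by case/andP => /eqP ? /eqP ?.
Qed.

Lemma steered_E e phi : steered phi -> steered (E e phi).
Proof.
case=> h0 h1; split; first by rewrite dir_E h0 (jm_EB2 M).
by rewrite dir_E h1 (jm_EB1 M).
Qed.

(** Transferring both factors to Bob gives the square of one of his observables. As operators, the
    two directions are only known to satisfy [Z^2 + X^2 = 2]. *)
Lemma steered_sqr phi b : steered phi -> D b (D b phi) = phi.
Proof.
case=> h0 h1; case: b; first by rewrite h1 dir_B1 h1 (jm_B1K M).
by rewrite h0 dir_B2 h0 (jm_B2K M).
Qed.

(* Replacing [phi] by [S phi] and steering it to Alice flips the sign. *)
Lemma dir_mean0 (phi : H) b (S N : {linear H -> H}) (k : R) :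
  hermitian_op S -> (forall u, S (S u) = u) ->
  (forall x u, A x (S u) = S (A x u)) -> (forall x u, A x (N u) = N (A x u)) ->
  N (S phi) = S (N phi) -> k ^+ 2 = 1 -> D (~~ b) phi = k%:C *: S phi ->
  dot H (D b (N phi)) phi = 0.
Proof.
move=> hS SK AS AN NS k2 Dphi.
have DS c u : D c (S u) = S (D c u) by apply: alice_dir_comm => x v; rewrite AS.
have DN c u : D c (N u) = N (D c u) by apply: alice_dir_comm => x v; rewrite AN.
have kk : k%:C * k%:C = 1 :> R[i] by rewrite -rmorphM -expr2 k2.
have DD : D (~~ b) (D (~~ b) phi) = phi.
  by rewrite Dphi dirZ DS Dphi (opZ S) SK scalerA kk scale1r.
suff e : dot H (D b (N phi)) phi = - dot H (D b (N phi)) phi.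
  by move/eqP: e; rewrite -addr_eq0 -mulr2n mulrn_eq0 => /eqP.
transitivity (dot H (D b (N (D (~~ b) phi))) (D (~~ b) phi)).
  rewrite Dphi (opZ N) dirZ dotZl dotZr_real mulrA kk mul1r.
  by rewrite NS DS hS SK.
have DDN' u : D (~~ b) (D b u) = - D b (D (~~ b) u) by rewrite DDN opprK.
by rewrite -(hD (~~ b)) DDN' DN DN DD dotNl -DN.
Qed.



Let hB1 y u v : dot H (B1 y u) v = dot H u (B1 y v) := jm_hermB1 M y u v.
Let hB2 y1 y2 u v : dot H (B2 y1 y2 u) v = dot H u (B2 y1 y2 v) := jm_hermB2 M y1 y2 u v.

(** Steering gives [<X B_1> = <Z B_00> = 1], so [<S_1> = sqrt 2 (1 + <Z B_0>)] and
    [<S_2> = sqrt 2 (1 + <X B_01>)]; the shifts by [sqrt 2] in [S_theta] remove the constant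
    terms. *)
Lemma max_Stheta_sum (P : correlation R) theta : extends_correlation P Q ->
  steered psi -> mean_Stheta P theta = Num.sqrt 2 ->
  (cos (2 * theta))%:C * dot H (D false (B1 false psi)) psi +
  (sin (2 * theta))%:C * dot H (D true (B2 false true psi)) psi = 1.
Proof.
move=> PQ [h0 h1] /(congr1 (real_complex R)).
rewrite /mean_Stheta; set c := cos _; set s := sin _.
rewrite /mean_S1 /mean_S2 !(rmorphD, rmorphN, rmorphM) /=.
rewrite !(mean_AB1_model PQ M, mean_AB2_model PQ M) => Sth.
have d1 : dot H (D true (B1 true psi)) psi = 1.
  by rewrite dir_B1 hB1 -h1 hD steered_sqr ?(jm_norm M).
have d0 : dot H (D false (B2 false false psi)) psi = 1.
  by rewrite dir_B2 hB2 -h0 hD steered_sqr ?(jm_norm M).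
apply: (mulfI (sqrt2C_neq0 R)); rewrite mulr1 -[RHS]Sth.
move: d0 d1; rewrite !alice_dirE !(dotDl, dotZl) expr0 expr1 => d0 d1.
have q0 := sqrt2C_neq0 R; set q := (Num.sqrt 2)%:C in q0 d0 d1 *.
have {}d0 : dot H (A false (B2 false false psi)) psi =
    q - dot H (A true (B2 false false psi)) psi.
  by rewrite -[q]mulr1 -d0; field.
have {}d1 : dot H (A false (B1 true psi)) psi = q + dot H (A true (B1 true psi)) psi.
  by rewrite -[q]mulr1 -d1; field.
by rewrite d0 d1; field.
Qed.

(** The vectors [Z B_0 psi] and [X B_01 psi] are unit, and by anticommutation their inner product
    has zero real part. Hence [c u + s v] is a unit vector with inner product 1 with psi, and its
    squared distance to psi expands to 0. *)
Lemma max_Stheta_fixed (c s : R) : c ^+ 2 + s ^+ 2 = 1 -> steered psi ->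
  c%:C * dot H (D false (B1 false psi)) psi +
  s%:C * dot H (D true (B2 false true psi)) psi = 1 ->
  c%:C *: D false (B1 false psi) + s%:C *: D true (B2 false true psi) = psi.
Proof.
move=> cs st W1.
have cc : c%:C * c%:C + s%:C * s%:C = 1 :> R[i] by rewrite -!rmorphM -rmorphD -!expr2 cs.
set u := D false _ in W1 *; set v := D true _ in W1 *.
have uu : dot H u u = 1.
  by rewrite /u hD dir_B1 hB1 dir_B1 (steered_sqr _ st) (jm_B1K M) (jm_norm M).
have vv : dot H v v = 1.
  by rewrite /v hD dir_B2 hB2 dir_B2 (steered_sqr _ st) (jm_B2K M) (jm_norm M).
have uv : dot H u v = - dot H v u.
  rewrite /u /v !hD -[true]/(~~ false) (DDN false) /= dotNr !dir_B1 !dir_B2.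
  rewrite hB1 hB2.
  by rewrite (jm_B12 M).
have pu : dot H psi u = dot H u psi by rewrite /u [RHS]hD hB1 dir_B1.
have pv : dot H psi v = dot H v psi by rewrite /v [RHS]hD hB2 dir_B2.
apply/subr0_eq/dot_eq0.
rewrite !(dotBl, dotBr, dotDl, dotDr, dotZl, dotZr_real) uu vv uv pu pv (jm_norm M).
transitivity ((c%:C * c%:C + s%:C * s%:C) + 1 -
  2 * (c%:C * dot H u psi + s%:C * dot H v psi)); first by ring.
by rewrite cc W1; ring.
Qed.

Lemma fixed_E (c s : R) e (phi : H) :
  c%:C *: D false (B1 false phi) + s%:C *: D true (B2 false true phi) = phi ->
  c%:C *: D false (B1 false (E e phi)) + s%:C *: D true (B2 false true (E e phi)) = E e phi.
Proof.
move=> W; rewrite -[in RHS]W (opD (E e)) !(opZ (E e)) -!dir_E.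
by rewrite (jm_EB1 M) (jm_EB2 M).
Qed.

(** The case of the identity for [N], with [S] the observable steering the other direction: [B_00]
    for X and [B_1] for Z. *)
Lemma dir_mean0_id phi b : steered phi -> dot H (D b phi) phi = 0.
Proof.
move=> [h0 h1]; rewrite -[phi in D b phi]/(idfun phi).
case: b.
  apply: (dir_mean0 (S := B2 false false) (N := idfun) (k := 1)) => //=.
  - exact: (jm_B2K M).
  - by move=> x u; rewrite (jm_AB2 M).
  - by rewrite expr1n.
  - by rewrite scale1r.
apply: (dir_mean0 (S := B1 true) (N := idfun) (k := 1)) => //=.
- exact: (jm_B1K M).
- by move=> x u; rewrite (jm_AB1 M).
- by rewrite expr1n.
- by rewrite scale1r.
Qed.

(* In the generic case the joint observable [B_0 B_01] anticommutes with [B_00] on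
   [phi], and Bob's three moments vanish by invariance under [B_00], [B_1] and [B_0]. *)
Lemma generic_moments (c s : R) phi : c != 0 -> s != 0 -> steered phi ->
  c%:C *: D false (B1 false phi) + s%:C *: D true (B2 false true phi) = phi ->
  [/\ dot H (B1 false phi) phi = 0, dot H (B2 false true phi) phi = 0 &
      dot H (B1 false (B2 false true phi)) phi = 0].
Proof.
move=> c0 s0 st W; have [h0 h1] := st.
have cC0 : c%:C != 0 by rewrite fmorph_eq0.
have sC0 : s%:C != 0 by rewrite fmorph_eq0.
(* Multiplying the fixed-point relation by [B_0], respectively [B_01], expresses both observables on
   phi through Alice's directions and [K = B_0 B_01]. *)
set K := fun u => B1 false (B2 false true u).
have KK u : K (K u) = u.
  by rewrite /K -(jm_B12 M) (jm_B1K M) (jm_B2K M).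
have hK u v : dot H (K u) v = dot H u (K v).
  by rewrite /K hB1 hB2 -(jm_B12 M).
have DK b u : D b (K u) = K (D b u) by rewrite /K dir_B1 dir_B2.
have B0phi : B1 false phi = c%:C *: D false phi + s%:C *: D true (K phi).
  rewrite -[in LHS]W (opD (B1 false)) !(opZ (B1 false)) -!dir_B1 (jm_B1K M).
  by [].
have B01phi : B2 false true phi = c%:C *: D false (K phi) + s%:C *: D true phi.
  rewrite -[in LHS]W (opD (B2 _ _)) !(opZ (B2 _ _)) -!dir_B2 (jm_B2K M).
  by rewrite /K (jm_B12 M).
have sqK b : D b (D b (K phi)) = K phi by rewrite !DK (steered_sqr _ st).
have DDt u : D false (D true u) = - D true (D false u) := DDN false u.
have sqD : D true (D true (D false (K phi))) = D false (D true (D true (K phi))).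
  by rewrite !DDt dirN opprK.
(* [B_0] commutes with [B_00], so [Z B_0 phi = B_00 B_0 phi]. After expanding [B_0 phi], the terms
   in [c] agree and [s] cancels; applying X to what remains produces the sign. *)
have anti : B2 false false (K phi) = - D false (K phi).
  have : D false (B1 false phi) = B2 false false (B1 false phi).
    by rewrite dir_B1 h0 (jm_B12 M).
  rewrite B0phi (opD (B2 _ _)) !(opZ (B2 _ _)) dirD !dirZ -!dir_B2 -h0.
  move/addrI/(scalerI sC0)/(congr1 (D true)); rewrite DDt dirN sqD sqK.
  by rewrite !dir_B2 sqK => ->.
have ZK : dot H (D false (K phi)) phi = 0.
  have e : dot H (D false (K phi)) phi = - dot H (D false (K phi)) phi.
    by rewrite {1}hD h0 -hB2 anti dotNl.
  by move/eqP: e; rewrite -addr_eq0 -mulr2n mulrn_eq0 => /eqP.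
have Z0 : dot H (D false phi) phi = 0 := dir_mean0_id false st.
have X0 : dot H (D true phi) phi = 0 := dir_mean0_id true st.
have K0 : dot H (K phi) phi = 0.
  have e : dot H (K phi) phi = - dot H (K phi) phi.
    transitivity (dot H (D false (K phi)) (D false phi)).
      by rewrite hD (steered_sqr false st).
    by rewrite h0 -[D false _]opprK -anti dotNl hB2 (jm_B2K M).
  by move/eqP: e; rewrite -addr_eq0 -mulr2n mulrn_eq0 => /eqP.
(* Z has mean zero on [B_0 phi] as well. Expanding [B_0 phi] on both sides leaves only the cross
   terms [2 c s <X K>]; this uses [c] and [s] both nonzero. *)
have XK : dot H (D true (K phi)) phi = 0.
  have : dot H (D false (B1 false phi)) (B1 false phi) = 0.
    by rewrite dir_B1 hB1 (jm_B1K M).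
  rewrite B0phi dirD !dirZ !(dotDl, dotDr) !(dotZl, dotZr_real).
  rewrite (steered_sqr false st).
  have -> : dot H phi (D false phi) = 0 by rewrite -hD.
  have -> : dot H phi (D true (K phi)) = dot H (D true (K phi)) phi.
    by rewrite -hD -hK -DK.
  have -> : dot H (D false (D true (K phi))) (D false phi) = dot H (D true (K phi)) phi.
    by rewrite hD (steered_sqr false st).
  have -> : dot H (D false (D true (K phi))) (D true (K phi)) = 0.
    by rewrite DDt dotNl hD sqK DK hK KK Z0 oppr0.
  set x := dot H _ _ => e.
  have {}e : (2 * (c%:C * s%:C)) * x = 0 by rewrite -[RHS]e; ring.
  by move/eqP: e; rewrite !mulf_eq0 pnatr_eq0 (negPf cC0) (negPf sC0) => /eqP.
split; last exact: K0.
  by rewrite B0phi dotDl !dotZl Z0 XK !mulr0 addr0.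
by rewrite B01phi dotDl !dotZl ZK X0 !mulr0 addr0.
Qed.

Lemma dot_joint_eigenproj (S T : {linear H -> H}) (b b' : bool) phi :
  dot H (eigenproj S b (eigenproj T b' phi)) phi = 4^-1 *
  (dot H phi phi + (-1) ^+ b * dot H (S phi) phi + (-1) ^+ b' * dot H (T phi) phi
   + (-1) ^+ b * (-1) ^+ b' * dot H (S (T phi)) phi).
Proof.
rewrite !eigenprojE (opZ S) (opD S) (opZ S) !(dotZl, dotDl).
by field.
Qed.

(** Eve's projector is idempotent and commutes with Bob, so it can be placed on both sides: her
    conditional statistics are Bob's statistics on [E_e psi]. *)
Lemma marginal_model b e :
  (marginal_BE Q b e (false, true))%:C =
  dot H (eigenproj (B1 false) b.1 (eigenproj (B2 false true) b.2 (E e psi))) (E e psi).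
Proof.
have EC (T : {linear H -> H}) o u : (forall v, E e (T v) = T (E e v)) ->
    E e (eigenproj T o u) = eigenproj T o (E e u).
  by move=> ET; apply: eigenproj_comm => //; exact: linearP.
rewrite /marginal_BE rmorph_sum /=; under eq_bigr do rewrite (jm_Q M) /= (jm_hermE M).
rewrite -dot_suml sum_eigenproj -(jm_hermE M).
rewrite EC => [|v]; last by rewrite (jm_EB1 M).
rewrite EC => [|v]; last by rewrite (jm_EB2 M).
rewrite -(jm_hermE M) EC => [|v]; last by rewrite (jm_EB1 M).
rewrite EC => [|v]; last by rewrite (jm_EB2 M).
by rewrite (jm_EE M) eqxx.
Qed.

Lemma sum_weights : \sum_e dot H (E e psi) (E e psi) = 1.
Proof.
under eq_bigr do rewrite -(jm_hermE M) (jm_EE M) eqxx.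
by rewrite -dot_suml (jm_sumE M) (jm_norm M).
Qed.

End Steering.

(** * Mixtures of deterministic qubit strategies *)

Section QubitStrategies.
Variable R : realType.
Implicit Types (d k o p q b : bool) (f : bool -> bool).

Definition pauli d p q : R[i] :=
  if d then (p != q)%:R else (p == q)%:R * (-1) ^+ p.

Arguments pauli : simpl never.

Definition outcome_proj d k o p q : R[i] :=
  ((p == q)%:R + (-1) ^+ o * (-1) ^+ k * pauli d p q) / 2.

(** The signed Pauli measurement is performed and its outcome [o] is announced as [f o]; a constant
    [f] is a deterministic answer. Relabellings of one measurement commute, as sequentiality
    requires. *)
Definition relabel_obs f d k p q : R[i] :=
  \sum_o (-1) ^+ (f o) * outcome_proj d k o p q.

Lemma outcome_proj_mul d k o o' p q :
  \sum_m outcome_proj d k o p m * outcome_proj d k o' m q =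
  (o == o')%:R * outcome_proj d k o p q.
Proof.
rewrite big_bool /outcome_proj /pauli.
by case: d; case: k; case: o; case: o'; case: p; case: q; rewrite /= !(expr0, expr1); field.
Qed.

Lemma outcome_proj_sum d k p q : \sum_o outcome_proj d k o p q = (p == q)%:R.
Proof. by rewrite big_bool /outcome_proj /= expr0 expr1; field. Qed.

Lemma outcome_proj_sym d k o p q : outcome_proj d k o p q = outcome_proj d k o q p.
Proof.
by rewrite /outcome_proj /pauli; case: d; case: p; case: q; rewrite /= ?mul0r.
Qed.

(** Functional calculus for a single projective measurement: functions of its outcome multiply
    pointwise. *)
Lemma outcome_proj_mul_sum d k (u v : bool -> R[i]) p q :
  \sum_m (\sum_o u o * outcome_proj d k o p m) * (\sum_o v o * outcome_proj d k o m q) =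
  \sum_o u o * v o * outcome_proj d k o p q.
Proof.
under eq_bigr do rewrite big_distrlr.
rewrite exchange_big; apply: eq_bigr => o _; rewrite exchange_big /=.
transitivity (\sum_o' u o * v o' * ((o == o')%:R * outcome_proj d k o p q)).
  apply: eq_bigr => o' _; rewrite -outcome_proj_mul mulr_sumr.
  by apply: eq_bigr => m _; ring.
rewrite (bigD1 o) //= eqxx mul1r big1 ?addr0 // => o' /negPf.
by rewrite eq_sym => ->; rewrite mul0r mulr0.
Qed.

Lemma relabel_obs_eigenproj f d k b p q :
  ((p == q)%:R + (-1) ^+ b * relabel_obs f d k p q) / 2 =
  \sum_o (f o == b)%:R * outcome_proj d k o p q.
Proof.
rewrite -(outcome_proj_sum d k) /relabel_obs mulr_sumr -big_split mulr_suml.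
apply: eq_bigr => o _ /=; move: (f o) => fo.
by case: fo; case: b; rewrite /= !(expr0, expr1); field.
Qed.

Lemma relabel_obs_sqr f d k p q :
  \sum_m relabel_obs f d k p m * relabel_obs f d k m q = (p == q)%:R.
Proof.
rewrite outcome_proj_mul_sum -(outcome_proj_sum d k).
by apply: eq_bigr => o _; rewrite -signr_addb addbb expr0 mul1r.
Qed.

Lemma relabel_obs_sym f d k p q : relabel_obs f d k p q = relabel_obs f d k q p.
Proof. by apply: eq_bigr => o _; rewrite outcome_proj_sym. Qed.

Lemma conj_pauli d p q : Num.conj (pauli d p q) = pauli d p q.
Proof. by rewrite /pauli; case: d; rewrite ?rmorphM ?rmorph_nat ?rmorph_sign. Qed.

Lemma conj_outcome_proj d k o p q :
  Num.conj (outcome_proj d k o p q) = outcome_proj d k o p q.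
Proof.
rewrite /outcome_proj rmorphM rmorphD !rmorphM !rmorph_sign /= conj_pauli.
by rewrite !rmorph_nat fmorphV rmorph_nat.
Qed.

Lemma conj_relabel_obs f d k p q :
  Num.conj (relabel_obs f d k p q) = relabel_obs f d k p q.
Proof.
rewrite rmorph_sum; apply: eq_bigr => o _.
by rewrite rmorphM rmorph_sign /= conj_outcome_proj.
Qed.

Local Notation r := ((Num.sqrt 2 : R)%:C).

Definition alice_obs x p q : R[i] := r^-1 * (pauli false p q + (-1) ^+ x * pauli true p q).

Lemma alice_obs_sqr (x : bool) p q :
  \sum_m alice_obs x p m * alice_obs x m q = (p == q)%:R.
Proof.
rewrite big_bool /alice_obs /pauli.
transitivity (r^-1 ^+ 2 * 2 * (p == q)%:R); last first.
  by rewrite exprVn sqrt2C_sqr mulVf ?mul1r ?pnatr_eq0.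
by case: x; case: p; case: q; rewrite /= !(expr0, expr1); ring.
Qed.

Lemma conj_alice_obs (x : bool) p q : Num.conj (alice_obs x p q) = alice_obs x q p.
Proof.
have e : Num.conj ((-1) ^+ x * pauli true p q) = (-1) ^+ x * pauli true p q.
  by rewrite rmorphM rmorph_sign /= conj_pauli.
rewrite /alice_obs rmorphM rmorphD /= e conj_pauli.
rewrite conj_Creal ?rpredV ?complex_real //.
by clear e; rewrite /pauli; case: p; case: q; rewrite /= ?mul0r.
Qed.

(* The sign of the Pauli observable [d] in A_x = (Z + (-1)^x X) / sqrt 2. *)
Definition dir_sign (x d : bool) : bool := x && d.

(** The double sum is twice the joint probability on a maximally entangled pair, where the amplitude
    1/2 is left out; the bias [1 / sqrt 2] is the overlap of A_x with a Pauli observable. *)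
Lemma alice_outcome_prob (a x d k o : bool) :
  \sum_p \sum_q ((p == q)%:R + (-1) ^+ a * alice_obs x p q) / 2 * outcome_proj d k o p q =
  (1 + (-1) ^+ (a (+) o (+) k (+) dir_sign x d) / r) / 2.
Proof.
rewrite !big_bool /alice_obs /outcome_proj /pauli; have r0 := sqrt2C_neq0 R.
by case: a; case: x; case: d; case: k; case: o; rewrite /= !(expr0, expr1); field.
Qed.

End QubitStrategies.

(** * Realizing a mixture with a label shared by Bob and Eve *)

Section Mixtures.
Variables (R : realType) (L : finType).
Implicit Types (M N : L -> bool -> bool -> R[i]).

(** Direct sum of 2 by 2 matrices over the labels: Bob reads the label without disturbing it and
    acts on his qubit accordingly. *)
Definition block_op M (i j : bool * L) : R[i] := (i.2 == j.2)%:R * M i.2 i.1 j.1.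

Lemma sum_block (l : L) (F : bool * L -> R[i]) :
  \sum_k (l == k.2)%:R * F k = \sum_m F (m, l).
Proof.
transitivity (\sum_m \sum_l' (l == l')%:R * F (m, l')).
  by rewrite pair_bigA; apply: eq_bigr => -[m l'].
apply: eq_bigr => m _; rewrite (bigD1 l) //= eqxx mul1r big1 ?addr0 // => l' /negPf.
by rewrite eq_sym => ->; rewrite mul0r.
Qed.

Lemma block_op_mul M N i j : \sum_k block_op M i k * block_op N k j =
  block_op (fun l p q => \sum_m M l p m * N l m q) i j.
Proof.
under eq_bigr do rewrite -mulrA.
rewrite (sum_block _ (fun k => M i.2 i.1 k.1 * block_op N k j)) /block_op mulr_sumr.
by apply: eq_bigr => m _ /=; ring.
Qed.

Lemma block_op_id M i j : (forall l p q, M l p q = (p == q)%:R) ->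
  block_op M i j = (i == j)%:R.
Proof.
by case: i j => [p l] [q l'] M1; rewrite /block_op /= M1 -natrM mulnb xpair_eqE andbC.
Qed.

Lemma eigenproj_block M o (u : l2_hilbert R (bool * L)%type) :
  eigenproj (l2op (block_op M) : {linear l2_hilbert R (bool * L)%type ->
    l2_hilbert R (bool * L)%type}) o u =
  l2op (block_op (fun l p q => ((p == q)%:R + (-1) ^+ o * M l p q) / 2)) u.
Proof.
rewrite eigenproj_l2op; apply: eq_l2op => -[p l] [q l'].
rewrite /block_op /= xpair_eqE andbC -mulnb natrM.
by ring.
Qed.

Variables (w : L -> R) (dir sgn : bool * bool -> bool).
Variables (f1 f2 : L -> bool * bool -> bool -> bool) (g : L -> bool * bool).

(** With weight [w l], Bob measures the signed Pauli observable of his inputs and announces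
    functions [f1], [f2] of its outcome that depend on the label, while Eve answers [g l]. *)
Definition mixture : correlationE R := fun a b e x y =>
  \sum_l (g l == e)%:R * w l *
    \sum_o (1 + (-1) ^+ (a (+) o (+) sgn y (+) dir_sign x (dir y)) / Num.sqrt 2) / 4 *
      ((f1 l y o == b.1) && (f2 l y o == b.2))%:R.

Hypothesis w_ge0 : forall l, 0 <= w l.
Hypothesis w_sum : \sum_l w l = 1.
(** Directions and relabellings are indexed by both inputs, but the first observable must be the
    same for both values of the second input. *)
Hypothesis f1_cons : forall l y p q,
  relabel_obs R (f1 l (y.1, false)) (dir (y.1, false)) (sgn (y.1, false)) p q =
  relabel_obs R (f1 l y) (dir y) (sgn y) p q.

Let HA := l2_hilbert R bool.
Let HB := l2_hilbert R (bool * L)%type.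
Let HE := l2_hilbert R L.
Let HAB := l2_tensor R bool (bool * L)%type.
Let HABE := l2_tensor R (bool * (bool * L))%type L.

Let A (x : bool) : {linear HA -> HA} := l2op (alice_obs R x).
Let B1mx y1 := block_op (fun l =>
  relabel_obs R (f1 l (y1, false)) (dir (y1, false)) (sgn (y1, false))).
Let B2mx y1 y2 := block_op (fun l =>
  relabel_obs R (f2 l (y1, y2)) (dir (y1, y2)) (sgn (y1, y2))).
Let B1 y1 : {linear HB -> HB} := l2op (B1mx y1).
Let B2 y1 y2 : {linear HB -> HB} := l2op (B2mx y1 y2).
Let Emx (e : bool * bool) (l l' : L) : R[i] := (l == l')%:R * (g l == e)%:R.
Let E e : {linear HE -> HE} := l2op (Emx e).
Let EmxE e (u : l2 R L) l : l2op (Emx e) u l = (g l == e)%:R * u l.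
Proof.
rewrite ffunE (bigD1 l) //= /Emx eqxx mul1r big1 ?addr0 // => l' /negPf.
by rewrite eq_sym => ->; rewrite !mul0r.
Qed.

(** The state is the superposition, with amplitudes [sqrt (w l)], of a maximally entangled qubit
    pair and a label held by both Bob and Eve; the 1/2 normalises the pair. All operators are
    diagonal in the label, so the statistics are those of the mixture. *)
Let amp l : R[i] := (Num.sqrt (w l / 2))%:C.
Let psi : l2 R ((bool * (bool * L)) * L)%type :=
  [ffun i => (i.1.1 == i.1.2.1)%:R * (i.1.2.2 == i.2)%:R * amp i.2].

Let amp2 l : amp l * amp l = (w l)%:C / 2.
Proof.
rewrite /amp -rmorphM -expr2 sqr_sqrtr ?divr_ge0 //.
by rewrite rmorphM fmorphV rmorph_nat.
Qed.

Let conj_psi i : Num.conj (psi i) = psi i.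
Proof.
by rewrite ffunE !rmorphM !rmorph_nat /= conj_Creal // complex_real.
Qed.

Let sum_psi (F : (bool * (bool * L)) * L -> R[i]) :
  \sum_i F i * psi i = \sum_l \sum_p F ((p, (p, l)), l) * amp l.
Proof.
transitivity (\sum_(j : bool * (bool * L)) \sum_l F (j, l) * psi (j, l)).
  by rewrite pair_bigA; apply: eq_bigr => -[].
rewrite exchange_big; apply: eq_bigr => l _ /=.
transitivity (\sum_p \sum_(k : bool * L) F ((p, k), l) * psi ((p, k), l)).
  by rewrite pair_bigA; apply: eq_bigr => -[].
apply: eq_bigr => p _.
transitivity (\sum_(k : bool * L) (l == k.2)%:R * ((p == k.1)%:R * F ((p, k), l) * amp l)).
  by apply: eq_bigr => k _; rewrite ffunE /= [k.2 == l]eq_sym; ring.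
rewrite sum_block (bigD1 p) //= eqxx mul1r big1 ?addr0 // => m /negPf.
by rewrite eq_sym => ->; rewrite !mul0r.
Qed.

Let psi_norm : `|psi : HABE| = 1.
Proof.
have : dot HABE psi psi = 1.
  rewrite /= /l2dot; under eq_bigr do rewrite conj_psi.
  rewrite sum_psi -[RHS](rmorph1 (real_complex R)) -w_sum rmorph_sum; apply: eq_bigr => l _.
  rewrite big_bool !ffunE /= !eqxx !mul1r amp2.
  by field.
rewrite dot_norm => /eqP; rewrite sqrf_eq1 => /orP[/eqP //|/eqP h].
by have := normr_ge0 (psi : HABE); rewrite h ler0N1.
Qed.

Let block_obs_unitary (f : L -> bool -> bool) d k :
  hermitian_unitary (l2op (block_op (fun l => relabel_obs R (f l) d k)) : {linear HB -> HB}).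
Proof.
apply: l2op_hermitian_unitary => i j.
  rewrite /block_op rmorphM rmorph_nat /= conj_relabel_obs relabel_obs_sym eq_sym.
  by have [->|] := eqVneq i.2 j.2; rewrite ?mul0r.
rewrite block_op_mul; apply: block_op_id => l p q; exact: relabel_obs_sqr.
Qed.

Theorem mixture_sequential_quantumE : sequential_quantumE mixture.
Proof.
exists HA, HB, HE, HAB, HABE, psi, A, B1, B2, E; split.
- exact: psi_norm.
- split=> [x|y1|y1 y2|y1 y2 u].
  + apply: l2op_hermitian_unitary => p q; first by rewrite conj_alice_obs.
    exact: alice_obs_sqr.
  + exact: block_obs_unitary.
  + exact: block_obs_unitary.
  + apply: (etrans (l2op_comp _ _ _)); apply: (etrans _ (esym (l2op_comp _ _ _))).
    apply: eq_l2op => i j; rewrite !block_op_mul /block_op; congr (_ * _).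
    (* The first observable is rewritten as a relabelling of the measurement used by the second one;
       both are then functions of one outcome. *)
    under eq_bigr do rewrite (f1_cons i.2 (y1, y2)).
    under [RHS]eq_bigr do rewrite (f1_cons i.2 (y1, y2)).
    rewrite !outcome_proj_mul_sum; apply: eq_bigr => o _; congr (_ * _); exact: mulrC.
- split=> [e|e e' u|u].
  + apply: l2op_hermitian => l l'; rewrite /Emx rmorphM !rmorph_nat eq_sym.
    by have [->|] := eqVneq l l'; rewrite ?mul0r.
  + apply/ffunP => l; rewrite EmxE EmxE; have [<-|ee'] := eqVneq e e'.
      by rewrite EmxE mulrA -natrM mulnb andbb.
    rewrite [RHS]ffunE; have [->|_] := eqVneq (g l) e; last by rewrite mul0r.
    by rewrite (negPf ee') mul0r mulr0.
  + apply/ffunP => l; rewrite sum_ffunE (bigD1 (g l)) //= EmxE eqxx mul1r.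
    by rewrite big1 ?addr0 // => e; rewrite eq_sym EmxE => /negPf ->; rewrite mul0r.
move=> a b e x y.
pose PA p q : R[i] := ((p == q)%:R + (-1) ^+ a * alice_obs R x p q) / 2.
pose NB l p q : R[i] := \sum_o ((f1 l y o == b.1)%:R * (f2 l y o == b.2)%:R) *
  outcome_proj R (dir y) (sgn y) o p q.
pose TM (i j : bool * (bool * L)) := PA i.1 j.1 * block_op NB i.2 j.2.
pose UM (i j : (bool * (bool * L)) * L) := TM i.1 j.1 * Emx e i.2 j.2.
exists (l2op TM : {linear HAB -> HAB}), (l2op UM : {linear HABE -> HABE}); split.
- apply: l2op_tensor => u; first exact: eigenproj_l2op.
  rewrite /= /B1 /B2 !eigenproj_block l2op_comp; apply: eq_l2op => i j.
  rewrite block_op_mul /block_op; congr (_ * _); rewrite /NB.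
  rewrite -outcome_proj_mul_sum; apply: eq_bigr => m _.
  rewrite (f1_cons i.2 y) !relabel_obs_eigenproj.
  by case: (y).
- exact: l2op_tensor.
rewrite /= /l2dot.
under [RHS]eq_bigr do rewrite conj_psi.
rewrite sum_psi rmorph_sum; apply: eq_bigr => l _.
have UE p : l2op UM psi (p, (p, l), l) =
    \sum_p' PA p p' * NB l p p' * (g l == e)%:R * amp l.
  rewrite ffunE sum_psi (bigD1 l) //= [X in _ + X]big1 ?addr0 => [|l' l'l].
    by apply: eq_bigr => p' _; rewrite /UM /TM /block_op /Emx /= eqxx mulr1n; ring.
  by rewrite big1 // => p' _; rewrite /UM /Emx /= eq_sym (negPf l'l) !(mul0r, mulr0).
transitivity (\sum_o (g l == e)%:R * (amp l * amp l) *
  ((f1 l y o == b.1)%:R * (f2 l y o == b.2)%:R) *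
  \sum_p \sum_p' PA p p' * outcome_proj R (dir y) (sgn y) o p p').
  rewrite rmorphM rmorphM rmorph_sum mulr_sumr /= amp2; apply: eq_bigr => o _.
  rewrite alice_outcome_prob -mulnb natrM !rmorphM /= !rmorph_nat fmorphV rmorphD rmorph1.
  rewrite rmorphM fmorphV rmorph_sign rmorph_nat /=.
  field.
  exact: sqrt2C_neq0.
under [RHS]eq_bigr do rewrite UE mulr_suml.
under [LHS]eq_bigr do rewrite mulr_sumr.
rewrite [LHS]exchange_big; apply: eq_bigr => p _ /=.
under [LHS]eq_bigr do rewrite mulr_sumr.
rewrite [LHS]exchange_big; apply: eq_bigr => p' _ /=.
rewrite /NB mulr_sumr !mulr_suml; apply: eq_bigr => o _; ring.
Qed.

End Mixtures.

(** * Factorization of the correlation *)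

Section EigenprojPositivity.
Variables (R : realType) (H : hilbertType R) (S T : {linear H -> H}).
Hypotheses (hS : hermitian_op S) (hT : hermitian_op T).
Hypotheses (SK : forall u, S (S u) = u) (TK : forall u, T (T u) = u).
Hypothesis ST : forall u, S (T u) = T (S u).

Lemma eigenproj_commute b b' u :
  eigenproj S b (eigenproj T b' u) = eigenproj T b' (eigenproj S b u).
Proof.
apply: eigenproj_comm => [|v]; first exact: linearP.
by apply/esym/eigenproj_comm => [|w]; [exact: linearP|rewrite ST].
Qed.

Lemma dot_joint_eigenproj_ge0 b b' u :
  0 <= dot H (eigenproj S b (eigenproj T b' u)) u.
Proof.
suff -> : dot H (eigenproj S b (eigenproj T b' u)) u =
    dot H (eigenproj S b (eigenproj T b' u)) (eigenproj S b (eigenproj T b' u)).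
  exact: dnorm_ge0.
rewrite -[in RHS]dot_eigenproj // eigenprojK // eigenproj_commute.
by rewrite -[in RHS]dot_eigenproj // eigenprojK.
Qed.

Lemma dot_joint_eigenproj_le b b' u :
  dot H (eigenproj S b (eigenproj T b' u)) u <= dot H (eigenproj S b u) u.
Proof.
have -> : dot H (eigenproj S b u) u =
    \sum_(o : bool) dot H (eigenproj S b (eigenproj T o u)) u.
  by rewrite -dot_suml -(linear_sum (eigenproj S b)) sum_eigenproj.
by rewrite (bigD1 b') //= lerDl sumr_ge0 // => o _; exact: dot_joint_eigenproj_ge0.
Qed.

End EigenprojPositivity.

Section Factorization.
Variables (R : realType) (P : correlation R) (Q : correlationE R).
Variables (H : hilbertType R) (psi : H).
Variables (A : bool -> {linear H -> H}) (B1 : bool -> {linear H -> H}).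
Variables (B2 : bool -> bool -> {linear H -> H}) (E : bool * bool -> {linear H -> H}).
Hypothesis PQ : extends_correlation P Q.
Hypothesis M : joint_model Q psi A B1 B2 E.

Local Notation D := (alice_dir A).
Local Notation r := ((Num.sqrt 2 : R)%:C).

Lemma steered_observable_mean0 (S : {linear H -> H}) d (k : bool) phi : steered A B1 B2 phi ->
  D d phi = (-1) ^+ k *: S phi -> dot H (S phi) phi = 0.
Proof.
move=> st Dphi; have := dir_mean0_id M d st.
rewrite Dphi dotZl => /eqP; rewrite mulf_eq0 signr_eq0 => /eqP //.
Qed.

(** [N psi] is an eigenvector of [S] with sign [t]. Steering by [S] fixes Alice's mean along [d] to
    a sign times the weight, and her mean along the other direction vanishes, so her outcome depends
    on Bob's only through [t]. *)
Lemma alice_factor (S N : {linear H -> H}) (a x d k t : bool) :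
  steered A B1 B2 psi ->
  hermitian_op S -> (forall u, S (S u) = u) ->
  (forall x u, A x (S u) = S (A x u)) -> (forall x u, A x (N u) = N (A x u)) ->
  N (S psi) = S (N psi) -> S (N psi) = (-1) ^+ t *: N psi ->
  D d psi = (-1) ^+ k *: S psi ->
  dot H (eigenproj (A x) a (N psi)) psi =
  (1 + (-1) ^+ (a (+) t (+) k (+) dir_sign x d) / r) / 2 * dot H (N psi) psi.
Proof.
move=> st hS SK AS AN NS SN Dpsi.
have e1 : dot H (D d (N psi)) psi = (-1) ^+ k * (-1) ^+ t * dot H (N psi) psi.
  have hD u v : dot H (D d u) v = dot H u (D d v) :=
    alice_dir_hermitian (jm_hermA M) d u v.
  rewrite hD Dpsi dotZr rmorph_sign -hS SN dotZl.
  by rewrite mulrA.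
have e0 : dot H (D (~~ d) (N psi)) psi = 0.
  apply: (dir_mean0 M (S := S) (k := (-1) ^+ k)) => //; first by rewrite sqrr_sign.
  by rewrite negbK rmorph_sign.
rewrite eigenprojE (alice_from_dir A) !(dotZl, dotDl).
have r0 := sqrt2C_neq0 R.
move: e1 e0; case: d {Dpsi} => /= -> ->;
  by case: a; case: x; case: k; case: t {SN}; rewrite /= !(expr0, expr1); field.
Qed.

Definition bob_prob (y b : bool * bool) : R := \sum_(a : bool) P a b false y.

Lemma bob_prob_model y b : (bob_prob y b)%:C =
  dot H (eigenproj (B1 y.1) b.1 (eigenproj (B2 y.1 y.2) b.2 psi)) psi.
Proof.
rewrite /bob_prob rmorph_sum; under eq_bigr do rewrite /= (correlation_model PQ M).
by rewrite -dot_suml sum_eigenproj.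
Qed.

Lemma bob_prob_ge0 y b : 0 <= bob_prob y b.
Proof.
rewrite -ler0c bob_prob_model; apply: dot_joint_eigenproj_ge0.
- exact: (jm_hermB1 M).
- exact: (jm_hermB2 M).
- exact: (jm_B1K M).
- exact: (jm_B2K M).
- exact: (jm_B12 M).
Qed.

Lemma bob_prob_sum2 y b1 : (\sum_(b2 : bool) bob_prob y (b1, b2))%:C =
  dot H (eigenproj (B1 y.1) b1 psi) psi.
Proof.
rewrite rmorph_sum; under eq_bigr do rewrite /= bob_prob_model /=.
rewrite -dot_suml -(linear_sum (eigenproj (B1 y.1) b1)) sum_eigenproj.
by [].
Qed.

Lemma factor_B1 (a x d k : bool) b y : steered A B1 B2 psi ->
  D d psi = (-1) ^+ k *: B1 y.1 psi ->
  P a b x y = (1 + (-1) ^+ (a (+) b.1 (+) k (+) dir_sign x d) / Num.sqrt 2) / 2 *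
    bob_prob y b.
Proof.
move=> st Dpsi; apply: complexI.
pose N : {linear H -> H} := eigenproj (B1 y.1) b.1 \o eigenproj (B2 y.1 y.2) b.2.
have AC x' o (S : {linear H -> H}) u : (forall v, A x' (S v) = S (A x' v)) ->
    A x' (eigenproj S o u) = eigenproj S o (A x' u).
  by move=> AS; apply: eigenproj_comm => //; exact: linearP.
have -> : (P a b x y)%:C = dot H (eigenproj (A x) a (N psi)) psi.
  by rewrite (correlation_model PQ M).
rewrite (alice_factor (S := B1 y.1) (t := b.1) (k := k) a x st _ _ _ _ _ _ Dpsi).
- rewrite rmorphM /= bob_prob_model; congr (_ * _).
  by rewrite rmorphM rmorphD rmorph1 rmorphM !fmorphV rmorph_sign rmorph_nat.
- exact: (jm_hermB1 M).
- exact: (jm_B1K M).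
- by move=> x' u; rewrite (jm_AB1 M).
- move=> x' u; rewrite /N /= AC => [|v]; last by rewrite (jm_AB1 M).
  by rewrite AC // => v; rewrite (jm_AB2 M).
- rewrite /N /= [RHS]eigenproj_comm => [||v]; [|exact: linearP|by []].
  congr eigenproj; apply/esym; apply: eigenproj_comm => [|v]; first exact: linearP.
  by rewrite (jm_B12 M).
- by rewrite /N /= op_eigenproj //; exact: (jm_B1K M).
Qed.

Lemma factor_B2 (a x d k : bool) b y : steered A B1 B2 psi ->
  D d psi = (-1) ^+ k *: B2 y.1 y.2 psi ->
  P a b x y = (1 + (-1) ^+ (a (+) b.2 (+) k (+) dir_sign x d) / Num.sqrt 2) / 2 *
    bob_prob y b.
Proof.
move=> st Dpsi; apply: complexI.
pose N : {linear H -> H} := eigenproj (B1 y.1) b.1 \o eigenproj (B2 y.1 y.2) b.2.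
have AC x' o (S : {linear H -> H}) u : (forall v, A x' (S v) = S (A x' v)) ->
    A x' (eigenproj S o u) = eigenproj S o (A x' u).
  by move=> AS; apply: eigenproj_comm => //; exact: linearP.
have B2N v : B2 y.1 y.2 (eigenproj (B1 y.1) b.1 v) = eigenproj (B1 y.1) b.1 (B2 y.1 y.2 v).
  by apply: eigenproj_comm => [|u]; [exact: linearP|rewrite (jm_B12 M)].
have -> : (P a b x y)%:C = dot H (eigenproj (A x) a (N psi)) psi.
  by rewrite (correlation_model PQ M).
rewrite (alice_factor (S := B2 y.1 y.2) (t := b.2) (k := k) a x st _ _ _ _ _ _ Dpsi).
- rewrite rmorphM /= bob_prob_model; congr (_ * _).
  by rewrite rmorphM rmorphD rmorph1 rmorphM !fmorphV rmorph_sign rmorph_nat.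
- exact: (jm_hermB2 M).
- exact: (jm_B2K M).
- by move=> x' u; rewrite (jm_AB2 M).
- move=> x' u; rewrite /N /= AC => [|v]; last by rewrite (jm_AB1 M).
  by rewrite AC // => v; rewrite (jm_AB2 M).
- rewrite /N /= B2N; congr eigenproj; apply/esym.
  by apply: eigenproj_comm => [|v //]; exact: linearP.
- by rewrite /N /= B2N op_eigenproj ?(opZ (eigenproj _ _)) //; exact: (jm_B2K M).
Qed.

Lemma bob_prob_uniform1 (k d : bool) y b1 : steered A B1 B2 psi ->
  D d psi = (-1) ^+ k *: B1 y.1 psi -> \sum_(b2 : bool) bob_prob y (b1, b2) = 2^-1.
Proof.
move=> st Dpsi; apply: complexI; rewrite bob_prob_sum2 eigenprojE dotZl dotDl dotZl.
by rewrite (steered_observable_mean0 st Dpsi) (jm_norm M) mulr0 addr0 mulr1 fmorphV rmorph_nat.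
Qed.

(** The second outcome is an unbiased coin independent of the first: [B_0] commutes with the
    observable steering the other direction, which kills the correlation. The marginal of the first
    outcome ignores [y2], hence the reading at 0. *)
Lemma bob_prob_uniform2 (k k' d : bool) y2 b : steered A B1 B2 psi ->
  D d psi = (-1) ^+ k *: B2 false y2 psi ->
  D (~~ d) psi = (-1) ^+ k' *: B2 false (~~ y2) psi ->
  bob_prob (false, y2) b = 2^-1 * \sum_(b2 : bool) bob_prob (false, false) (b.1, b2).
Proof.
move=> st Dpsi D'psi; apply: complexI; rewrite rmorphM fmorphV rmorph_nat /=.
rewrite bob_prob_sum2 bob_prob_model dot_joint_eigenproj /=.
rewrite (steered_observable_mean0 st Dpsi).
have -> : dot H (B1 false (B2 false y2 psi)) psi = 0.
  have e : dot H (D d (B1 false psi)) psi = 0.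
    apply: (dir_mean0 M (S := B2 false (~~ y2)) (k := (-1) ^+ k')).
    - exact: (jm_hermB2 M).
    - exact: (jm_B2K M).
    - by move=> x u; rewrite (jm_AB2 M).
    - by move=> x u; rewrite (jm_AB1 M).
    - by rewrite (jm_B12 M).
    - by rewrite sqrr_sign.
    - by rewrite D'psi rmorph_sign.
  move: e; rewrite (dir_B1 M) Dpsi (opZ (B1 _)) dotZl => /eqP.
  by rewrite mulf_eq0 signr_eq0 => /eqP.
by rewrite eigenprojE dotZl dotDl dotZl; field.
Qed.

End Factorization.

(** * Guessing probability *)

Lemma cos2Dsin2_2theta (R : realType) (theta : R) :
  cos (2 * theta) ^+ 2 + sin (2 * theta) ^+ 2 = 1.
Proof. exact: cos2Dsin2. Qed.

Lemma sqr_eq1_sign (R : realType) (x : R) : x ^+ 2 = 1 -> exists k : bool, x = (-1) ^+ k.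
Proof.
by move/eqP; rewrite sqrf_eq1 => /orP[] /eqP ->; [exists false|exists true].
Qed.

(** When one coefficient vanishes the other is a sign, and the fixed-point relation becomes a third
    steering equation, for [B_0] or for [B_01]. *)
Lemma degenerate_steering (R : realType) (P : correlation R) (Q : correlationE R)
    (H : hilbertType R) (psi : H) A B1 B2 E theta :
  extends_correlation P Q -> joint_model Q psi A B1 B2 E ->
  mean_Stheta P theta = Num.sqrt 2 -> steered A B1 B2 psi ->
  cos (2 * theta) = 0 \/ sin (2 * theta) = 0 ->
  (exists k : bool, alice_dir A false psi = (-1) ^+ k *: B1 false psi) \/
  (exists k : bool, alice_dir A true psi = (-1) ^+ k *: B2 false true psi).
Proof.
move=> PQ M St st cs0; have cs1 := cos2Dsin2_2theta theta.
have := max_Stheta_fixed M cs1 st (max_Stheta_sum M PQ st St).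
case: cs0 => e0; rewrite e0 expr0n ?addr0 ?add0r in cs1 *;
    have [k ek] := sqr_eq1_sign cs1; rewrite ek rmorph_sign.
  rewrite scale0r add0r => W; right; exists k; rewrite -[in RHS]W (opZ (B2 _ _)).
  by rewrite -(dir_B2 M) (jm_B2K M) scalerA -signr_addb addbb scale1r.
rewrite scale0r addr0 => W; left; exists k; rewrite -[in RHS]W (opZ (B1 _)).
by rewrite -(dir_B1 M) (jm_B1K M) scalerA -signr_addb addbb scale1r.
Qed.

Section GuessBounds.
Variables (R : realType) (P : correlation R) (Q : correlationE R).
Hypotheses (PQ : extends_correlation P Q) (QE : sequential_quantumE Q).
Hypothesis Sc : mean_Sc P = 2 * Num.sqrt 2.

Local Notation guess := (\sum_(b : bool * bool) marginal_BE Q b b (false, true)).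

(** Each correct guess contributes a quarter of the weight of Eve's outcome. The equality holds for
    every extension, so it yields both the bound and its attainment. *)
Lemma guess_generic theta : mean_Stheta P theta = Num.sqrt 2 ->
  cos (2 * theta) != 0 -> sin (2 * theta) != 0 -> guess = 4^-1.
Proof.
move=> St c0 s0; have [H [psi [A [B1 [B2 [E M]]]]]] := sequential_quantumE_model QE.
have st := max_Sc_steered M PQ Sc.
have W := max_Stheta_fixed M (cos2Dsin2_2theta theta) st (max_Stheta_sum M PQ st St).
apply: complexI; rewrite rmorph_sum /=.
transitivity (\sum_e 4^-1 * dot H (E e psi) (E e psi)).
  apply: eq_bigr => b _; rewrite (marginal_model M) dot_joint_eigenproj.
  have [-> -> ->] := generic_moments M c0 s0 (steered_E M b st) (fixed_E M b W).
  by rewrite !mulr0 !addr0.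
by rewrite -mulr_sumr (sum_weights M) mulr1 fmorphV rmorph_nat.
Qed.

(** Guessing both outcomes is at most as likely as guessing the Pauli one alone, and that one is
    uniform on every conditional vector. *)
Lemma guess_le_half theta : mean_Stheta P theta = Num.sqrt 2 ->
  cos (2 * theta) = 0 \/ sin (2 * theta) = 0 -> guess <= 2^-1.
Proof.
move=> St cs0; have [H [psi [A [B1 [B2 [E M]]]]]] := sequential_quantumE_model QE.
have st := max_Sc_steered M PQ Sc.
rewrite -lecR rmorph_sum /= fmorphV rmorph_nat.
have -> : (2^-1 : R[i]) = \sum_e 2^-1 * dot H (E e psi) (E e psi).
  by rewrite -mulr_sumr (sum_weights M) mulr1.
apply: ler_sum => b _.
rewrite (marginal_model M); set phi := E b psi.
have stphi : steered A B1 B2 phi := steered_E M b st.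
have [[k B0psi]|[k B01psi]] := degenerate_steering PQ M St st cs0.
  have B0phi : alice_dir A false phi = (-1) ^+ k *: B1 false phi.
    by rewrite /phi (dir_E M) B0psi (opZ (E b)) (jm_EB1 M).
  apply: le_trans (dot_joint_eigenproj_le (jm_hermB1 M false) (jm_hermB2 M false true)
    (jm_B1K M false) (jm_B2K M false true) (jm_B12 M false true) _ _ _) _.
  rewrite eigenprojE dotZl dotDl dotZl.
  by rewrite (steered_observable_mean0 M stphi B0phi) mulr0 addr0.
have B01phi : alice_dir A true phi = (-1) ^+ k *: B2 false true phi.
  by rewrite /phi (dir_E M) B01psi (opZ (E b)) (jm_EB2 M).
have B21 u : B2 false true (B1 false u) = B1 false (B2 false true u) := esym (jm_B12 M false true u).
rewrite -(eigenproj_commute B21).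
apply: le_trans (dot_joint_eigenproj_le (jm_hermB2 M false true) (jm_hermB1 M false)
    (jm_B2K M false true) (jm_B1K M false) B21 _ _ _) _.
rewrite eigenprojE dotZl dotDl dotZl.
by rewrite (steered_observable_mean0 M stphi B01phi) mulr0 addr0.
Qed.

End GuessBounds.

(** * Independent coins gathered into one label *)

Section ProductWeights.
Variables (R : realType) (I : finType) (v : I -> bool -> R).
Hypothesis v_ge0 : forall i b, 0 <= v i b.
Hypothesis v_sum : forall i, \sum_(b : bool) v i b = 1.

(** One biased coin for each index, all tossed in advance: a label records every answer that could
    be asked for. *)
Definition product_weight (l : {ffun I -> bool}) : R := \prod_i v i (l i).

Lemma product_weight_ge0 l : 0 <= product_weight l.
Proof. by apply: prodr_ge0. Qed.

Lemma product_weight_sum : \sum_l product_weight l = 1.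
Proof.
rewrite -(bigA_distr_bigA (fun i b => v i b)) big1 // => i _; exact: v_sum.
Qed.

Lemma product_weight_marginal i0 b0 :
  \sum_l product_weight l * (l i0 == b0)%:R = v i0 b0.
Proof.
pose F i b := v i b * (if i == i0 then (b == b0)%:R else 1).
transitivity (\sum_(l : {ffun I -> bool}) \prod_i F i (l i)).
  apply: eq_bigr => l _; rewrite big_split /=; congr (_ * _).
  by rewrite (bigD1 i0) //= eqxx big1 ?mulr1 // => i /negPf ->.
rewrite -(bigA_distr_bigA F) (bigD1 i0) //= [X in _ * X]big1 ?mulr1; last first.
  move=> i /negPf ii0; rewrite -[RHS](v_sum i); apply: eq_bigr => b _.
  by rewrite /F ii0 mulr1.
by rewrite (bigD1 b0) //= /F !eqxx mulr1 big1 ?addr0 // => b /negPf ->; rewrite mulr0.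
Qed.

End ProductWeights.

Section MixtureMarginals.
Variables (R : realType) (L : finType) (w : L -> R) (dir sgn : bool * bool -> bool).
Variables (f1 f2 : L -> bool * bool -> bool -> bool) (g : L -> bool * bool).

Local Notation mix := (mixture w dir sgn f1 f2 g).

Lemma mixture_sumE a b x y : \sum_e mix a b e x y = \sum_l w l *
  \sum_(o : bool) (1 + (-1) ^+ (a (+) o (+) sgn y (+) dir_sign x (dir y)) / Num.sqrt 2) / 4 *
      ((f1 l y o == b.1) && (f2 l y o == b.2))%:R.
Proof.
rewrite exchange_big; apply: eq_bigr => l _ /=.
rewrite (bigD1 (g l)) //= eqxx mul1r [X in _ + X]big1 ?addr0 // => e /negPf.
by rewrite eq_sym => ->; rewrite !mul0r.
Qed.

Lemma mixture_guess y : \sum_b marginal_BE mix b b y = \sum_l w l *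
  \sum_(o : bool) 2^-1 * ((f1 l y o, f2 l y o) == g l)%:R.
Proof.
transitivity (\sum_b \sum_l (g l == b)%:R * (w l *
  \sum_(o : bool) 2^-1 * ((f1 l y o, f2 l y o) == b)%:R)).
  apply: eq_bigr => b _; rewrite /marginal_BE exchange_big; apply: eq_bigr => l _ /=.
  rewrite -mulr_sumr mulrA; congr (_ * _); rewrite exchange_big /=.
  apply: eq_bigr => o _; rewrite -mulr_suml; congr (_ * _).
  have r0 : Num.sqrt 2 != 0 :> R by rewrite gt_eqF // sqrtr_gt0 ltr0n.
  (* Alice's two biases cancel in the sum over her outcome, leaving probability 1/2 for [o]. *)
  rewrite big_bool; case: o; case: (sgn y);
    by rewrite /= !(expr0, expr1); field.
rewrite exchange_big; apply: eq_bigr => l _ /=.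
rewrite (bigD1 (g l)) //= eqxx mul1r [X in _ + X]big1 ?addr0 // => e /negPf.
by rewrite eq_sym => ->; rewrite !mul0r.
Qed.

End MixtureMarginals.

(** * Optimal strategies for Eve in the degenerate case *)

Section Achievability.
Variables (R : realType) (P : correlation R) (Q0 : correlationE R).
Variables (H : hilbertType R) (psi : H).
Variables (A : bool -> {linear H -> H}) (B1 : bool -> {linear H -> H}).
Variables (B2 : bool -> bool -> {linear H -> H}) (E : bool * bool -> {linear H -> H}).
Hypothesis PQ : extends_correlation P Q0.
Hypothesis M : joint_model Q0 psi A B1 B2 E.
Hypothesis st : steered A B1 B2 psi.

Local Notation I := ((bool * bool) * bool)%type.
Local Notation achieves_half := (exists Q : correlationE R,
  [/\ extends_correlation P Q, sequential_quantumE Q &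
      2^-1 = \sum_b marginal_BE Q b b (false, true)]).

(* Given the first outcome, the second one is classical noise whose values are
   revealed to Eve by the label [l]; she cannot do better than guess the first. *)
Lemma achieves_half_first (k : bool) :
  alice_dir A false psi = (-1) ^+ k *: B1 false psi -> achieves_half.
Proof.
move=> B0psi.
pose sgn (y : bool * bool) := if y.1 then false else k.
have rel y : alice_dir A y.1 psi = (-1) ^+ sgn y *: B1 y.1 psi.
  by rewrite /sgn; case: y => [[] y2] /=; [rewrite scale1r; exact: st.2|].
(* The first outcome has probability 1/2, so the factor 2 gives the conditional law of the second
   one. *)
pose v (i : I) b := 2 * bob_prob P i.1 (i.2, b).
have v0 i b : 0 <= v i b by rewrite mulr_ge0 // (bob_prob_ge0 PQ M).
have v1 i : \sum_(b : bool) v i b = 1.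
  rewrite -mulr_sumr (bob_prob_uniform1 PQ M _ st (rel i.1)).
  by rewrite divff.
pose f1 (l : {ffun I -> bool}) (y : bool * bool) (o : bool) := o.
pose f2 (l : {ffun I -> bool}) (y : bool * bool) (o : bool) := l (y, o).
(* Eve bets on [false] for the first outcome and reads off the label the second outcome that would
   follow; she is right exactly when the bet is. *)
pose g (l : {ffun I -> bool}) := (false, l ((false, true), false)).
exists (mixture (product_weight v) (fun y => y.1) sgn f1 f2 g); split.
- move=> a b x y; rewrite mixture_sumE (factor_B1 PQ M _ _ _ st (rel y)).
  transitivity (\sum_l ((1 + (-1) ^+ (a (+) b.1 (+) sgn y (+) dir_sign x y.1) / Num.sqrt 2) / 4)
     * (product_weight v l * (l (y, b.1) == b.2)%:R)).
    apply: eq_bigr => l _; rewrite (bigD1 b.1) //= eqxx big1 ?addr0 => [|o /negPf ob].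
      by rewrite /f2 /=; ring.
    by rewrite /f1 ob mulr0.
  rewrite -mulr_sumr product_weight_marginal // /v /=.
  by case: b => b1 b2 /=; field.
- apply: mixture_sequential_quantumE => //.
  + by move=> l; exact: product_weight_ge0.
  + exact: product_weight_sum.
rewrite mixture_guess; transitivity (\sum_l product_weight v l * 2^-1).
  by rewrite -mulr_suml (product_weight_sum v1) mul1r.
apply: eq_bigr => l _; congr (_ * _).
by rewrite big_bool /f1 /f2 /g !xpair_eqE !eqxx /= ?andbF mulr0 add0r mulr1.
Qed.

(** A deterministic answer is a signed identity whatever the direction measured, so on first input 0
    the first observable is the same for both second inputs although the Pauli direction changes. *)
Lemma relabel_obs_const (c d k p q : bool) :
  relabel_obs R (fun=> c) d k p q = (-1) ^+ c * (p == q)%:R.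
Proof. by rewrite /relabel_obs -mulr_sumr outcome_proj_sum. Qed.

(* Here it is the first outcome on input 0 that is classical noise known to Eve. *)
Lemma achieves_half_second (k : bool) :
  alice_dir A true psi = (-1) ^+ k *: B2 false true psi -> achieves_half.
Proof.
move=> B01psi.
pose sgn (y : bool * bool) := if y.1 then false else if y.2 then k else false.
pose dir (y : bool * bool) := if y.1 then true else y.2.
have rel1 (y2 : bool) : alice_dir A true psi = (-1) ^+ false *: B1 (true, y2).1 psi.
  by rewrite scale1r; exact: st.2.
have rel2 y2 : alice_dir A y2 psi = (-1) ^+ (if y2 then k else false) *: B2 false y2 psi.
  by case: y2 => //; rewrite scale1r; exact: st.1.
have rel2' y2 : alice_dir A (~~ y2) psi =
    (-1) ^+ (if y2 then false else k) *: B2 false (~~ y2) psi.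
  by case: y2 => //=; rewrite scale1r; exact: st.1.
(* On first input 1 the coin is the second outcome given the first; on first input 0 it is the first
   outcome itself. *)
pose v (i : I) b := if i.1.1 then 2 * bob_prob P i.1 (i.2, b)
  else \sum_(b2 : bool) bob_prob P (false, false) (b, b2).
have v0 i b : 0 <= v i b.
  rewrite /v; case: ifP => _; first by rewrite mulr_ge0 // (bob_prob_ge0 PQ M).
  by apply: sumr_ge0 => b2 _; exact: (bob_prob_ge0 PQ M).
have v1 i : \sum_(b : bool) v i b = 1.
  rewrite /v; case: i => [[[] y2] o] /=.
    by rewrite -mulr_sumr (bob_prob_uniform1 PQ M _ st (rel1 y2)) divff.
  apply: complexI; rewrite rmorph_sum; under eq_bigr do rewrite /= (bob_prob_sum2 PQ M).
  by rewrite -dot_suml sum_eigenproj (jm_norm M).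
(* A single coin serves both second inputs, so the first outcome on input 0 does not depend on
   [y2]. *)
pose i0 : I := ((false, false), false).
pose f1 (l : {ffun I -> bool}) (y : bool * bool) (o : bool) := if y.1 then o else l i0.
pose f2 (l : {ffun I -> bool}) (y : bool * bool) (o : bool) := if y.1 then l (y, o) else o.
pose g (l : {ffun I -> bool}) := (l i0, false).
exists (mixture (product_weight v) dir sgn f1 f2 g); split.
- move=> a b x y; rewrite mixture_sumE.
  case: y => [[] y2].
    rewrite (factor_B1 PQ M _ _ _ st (rel1 y2)).
    transitivity (\sum_l ((1 + (-1) ^+ (a (+) b.1 (+) false (+) dir_sign x true) / Num.sqrt 2) / 4)
       * (product_weight v l * (l ((true, y2), b.1) == b.2)%:R)).
      apply: eq_bigr => l _; rewrite (bigD1 b.1) //= eqxx big1 ?addr0 => [|o /negPf ob].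
        by rewrite /f2 /=; ring.
      by rewrite /f1 /= ob mulr0.
    rewrite -mulr_sumr product_weight_marginal // /v /=.
    by case: b => b1 b2 /=; field.
  rewrite (factor_B2 (y := (false, y2)) PQ M _ _ _ st (rel2 y2)).
  rewrite (bob_prob_uniform2 PQ M _ st (rel2 y2) (rel2' y2)).
  transitivity (\sum_l ((1 + (-1) ^+ (a (+) b.2 (+) sgn (false, y2) (+) dir_sign x y2) / Num.sqrt 2) / 4)
       * (product_weight v l * (l i0 == b.1)%:R)).
    apply: eq_bigr => l _; rewrite (bigD1 b.2) //= eqxx big1 ?addr0 => [|o /negPf ob].
      by rewrite /f1 /= andbT; ring.
    by rewrite /f2 /= ob andbF mulr0.
  rewrite -mulr_sumr product_weight_marginal // /v /=.
  by field.
- apply: mixture_sequential_quantumE => //.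
  + by move=> l; exact: product_weight_ge0.
  + exact: product_weight_sum.
  + move=> l [[] y2] p q //=.
    by rewrite !(relabel_obs_const (l i0)).
rewrite mixture_guess; transitivity (\sum_l product_weight v l * 2^-1).
  by rewrite -mulr_suml (product_weight_sum v1) mul1r.
apply: eq_bigr => l _; congr (_ * _).
by rewrite big_bool /f1 /f2 /g !xpair_eqE !eqxx /= ?andbF mulr0 add0r mulr1.
Qed.

End Achievability.

(** * Angles and the main theorem *)

Lemma sin_intpi (R : realType) (x : R) (n : int) : sin x = 0 -> sin (x + n%:~R * pi) = 0.
Proof.
move=> sx; have nat_case (m : nat) y : sin y = 0 -> sin (y + m%:R * pi) = 0.
  move=> sy; elim: m => [|m IHm]; first by rewrite mul0r addr0.
  by rewrite -natr1 mulrDl mul1r addrA sinDpi IHm oppr0.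
case: n => m; first exact: nat_case.
have -> : x + (Negz m)%:~R * pi = - (- x + m.+1%:R * pi).
  by rewrite NegzE mulrNz opprD opprK mulNr.
by rewrite sinN nat_case ?oppr0 // sinN sx oppr0.
Qed.

(** Subtracting the multiple of pi given by a floor brings [x] into [[0, pi)], where the sine is
    positive except at 0. *)
Lemma sin_eq0_intpi (R : realType) (x : R) : sin x = 0 <-> exists n : int, x = n%:~R * pi.
Proof.
split=> [sx|[n ->]]; last by rewrite -[_ * pi]add0r sin_intpi ?sin0.
have pi0 : 0 < pi :> R by exact: pi_gt0.
exists (Num.floor (x / pi)).
set n := Num.floor _; pose y := x + (- n)%:~R * pi.
have /andP[fl fu] := floor_itv (x / pi).
have y0 : 0 <= y by rewrite /y mulrNz mulNr subr_ge0 -ler_pdivlMr.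
have ypi : y < pi.
  rewrite /y mulrNz mulNr ltrBlDr -[X in X + _]mul1r -mulrDl -ltr_pdivrMr //.
  by rewrite addrC -intrD1.
have sy : sin y = 0 by exact: sin_intpi.
have : y = 0.
  apply/eqP; rewrite eq_le y0 andbT leNgt; apply/negP => y_gt0.
  by have := @sin_gt0_pi R y; rewrite y_gt0 ypi sy ltxx => /(_ isT).
by rewrite /y mulrNz mulNr => /subr0_eq.
Qed.

(** Both sides say that [sin (4 theta) = 2 cos (2 theta) sin (2 theta)] vanishes. *)
Lemma cos_sin_2theta_eq0 (R : realType) (theta : R) :
  (cos (2 * theta) = 0 \/ sin (2 * theta) = 0) <->
  exists n : int, theta = n%:~R * (pi / 4).
Proof.
have e4 : sin (4 * theta) = 2 * (cos (2 * theta) * sin (2 * theta)).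
  have -> : 4 * theta = 2 * theta + 2 * theta by ring.
  by rewrite sinD; ring.
have -> : (exists n : int, theta = n%:~R * (pi / 4)) <-> sin (4 * theta) = 0.
  rewrite sin_eq0_intpi; split=> -[n e]; exists n; first by rewrite e; field.
  by rewrite mulrA -e; field.
rewrite e4; split=> [[->|->]|/eqP]; rewrite ?mul0r ?mulr0 //.
by rewrite !mulf_eq0 pnatr_eq0 /= => /orP[] /eqP ->; [left|right].
Qed.

Lemma min_entropyV (R : realType) (P : correlation R) y (n : nat) :
  is_guessing_probability P y (2^-1 ^+ n) -> is_min_entropy P y n%:R.
Proof.
have l2 : 0 < ln (2 : R) by rewrite ln_gt0 // ltr1n.
move=> HG; exists (2^-1 ^+ n) => //.
rewrite lnXn ?invr_gt0 // lnV ?posrE // -[(- ln 2) *+ n]mulr_natr.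
by field; rewrite gt_eqF.
Qed.

Theorem mainTheorem2 (R : realType) (Pexp : correlation R)
    (HP : sequential_quantum Pexp)
    (HSc : mean_Sc Pexp = 2 * Num.sqrt 2) :
  (forall theta : R,
     (forall n : int, theta <> n%:~R * (pi / 4)) ->
     mean_Stheta Pexp theta = Num.sqrt 2 ->
     is_min_entropy Pexp (false, true) 2) /\
  (forall theta : R,
     (exists n : int, theta = n%:~R * (pi / 4)) ->
     mean_Stheta Pexp theta = Num.sqrt 2 ->
     is_min_entropy Pexp (false, true) 1).
Proof.
(* The trivial extension attains 1/4 in the generic case; in the degenerate case it only provides
   commuting operators realizing [Pexp], from which the optimal extension is built. *)
have QE := sequential_quantum_trivialE HP.
set Q0 : correlationE R := fun a b e x y => _ in QE.
have PQ0 : extends_correlation Pexp Q0.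
  move=> a b x y; rewrite (bigD1 (false, false)) //= /Q0 eqxx mul1r.
  by rewrite big1 ?addr0 // => e /negPf ->; rewrite mul0r.
split=> theta Htheta St.
  have cs0 : ~ (cos (2 * theta) = 0 \/ sin (2 * theta) = 0).
    by move/cos_sin_2theta_eq0 => [n]; exact: Htheta.
  have c0 : cos (2 * theta) != 0 by apply/eqP => e; apply: cs0; left.
  have s0 : sin (2 * theta) != 0 by apply/eqP => e; apply: cs0; right.
  have quarter : (2^-1 : R) ^+ 2 = 4^-1 by field.
  apply: min_entropyV; rewrite quarter; split.
    by exists Q0; split=> //; rewrite (guess_generic PQ0 QE HSc St c0 s0).
  by move=> _ [Q [PQ QEQ ->]]; rewrite (guess_generic PQ QEQ HSc St c0 s0).
have cs0 := (cos_sin_2theta_eq0 theta).2 Htheta.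
apply: (@min_entropyV _ _ _ 1); rewrite expr1; split; last first.
  by move=> _ [Q [PQ QEQ ->]]; exact: (guess_le_half PQ QEQ HSc St cs0).
have [H [psi [A [B1 [B2 [E M]]]]]] := sequential_quantumE_model QE.
have st := max_Sc_steered M PQ0 HSc.
have [[k rel]|[k rel]] := degenerate_steering PQ0 M St st cs0.
  exact: (achieves_half_first PQ0 M st rel).
exact: (achieves_half_second PQ0 M st rel).
Qed.
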